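(* (D1) Over $(M_2,\mathrm{tr})$, the irreflexive complete quantum graph $A_4=J-\mathrm{id}$ and the quantum square $A_3$, given by $A_3(e_{11})=2e_{22}$, $A_3(e_{22})=2e_{11}$, $A_3(e_{12})=A_3(e_{21})=0$, are connected and $3$-point regular, with parameters $(k,\lambda,\mu,q_3,q_2,q_1,q_0)$ equal to $(3,2,0,1,0,0,0)$ for $A_4$ and $(2,0,2,0,0,0,0)$ for $A_3$. (D2) Over $(M_3,\mathrm{tr})$, the following four operators define irreflexive real undirected $3$-point regular quantum graphs, no two of which are equal or complementary to each other: (a) $G_3$: $G_3(e_{ii})=2e_{ii}$ and $G_3(e_{ij})=-e_{ij}$ for $i\ne j$; (b) $G_4$: $G_4(e_{ii})=\tfrac32\sum_{j\ne i}e_{jj}$ and $G_4(e_{ij})=\tfrac32e_{ji}$ for $i\neq j$; (c) $9P_q$: the operator with matrix entries $\hat T_{ij}^{kl}=\delta_{i-j,k-l}+3\delta_{ijkl}-2\delta_{ik}\delta_{jl}$ in the matrix units ($i,j,k,l$ taken modulo $3$, $\delta_{ijkl}=1$ if $i=j=k=l$ and $0$ otherwise); (d) the irreflexive complete graph $\mathcal K_{M_3}^{\mathsf{irref}}$: $J-\mathrm{id}$. Their parameters $(k,\lambda,\mu,q_3,q_2,q_1,q_0)$ are respectively (a) $(2,1,0,0,0,0,0)$; (b) $(3,\tfrac34,\tfrac34,\tfrac38,-\tfrac38,\tfrac38,-\tfrac38)$; (c) $(4,1,2,0,0,1,0)$; (d) $(8,7,0,6,0,0,0)$. (D3) There exist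 quantum graphs over finite quantum sets with non-commutative underlying C*-algebra that are quantum isomorphic to, and strongly regular with the same parameters as, the Schläfli graph (with parameters $(n,k,\lambda,\mu)=(27,16,10,8)$), respectively the Shrikhande graph (with parameters $(16,6,2,2)$).
   Context: Finite quantum sets. A finite quantum set $X$ is a finite-dimensional C*-algebra $A$ with a faithful state $\psi$; $\ell^2(X)$ denotes $A$ with inner product $\langle a,b\rangle=\psi(a^*b)$, $m$ the multiplication, $\iota:\mathbb C\to\ell^2(X)$ the unit map, $m^\dagger,\iota^\dagger$ their adjoints, and it is required that $m m^\dagger=\delta^2\,\mathrm{id}$ for some $\delta>0$. For $(M_n,\mathrm{tr})$ with normalized trace, $\delta^2=n^2$; $e_{ij}$ are the matrix units. Put $\mathrm{ev}_X=\iota^\dagger m$, $\mathrm{coev}_X=m^\dagger\iota$, $J=\delta^2\iota\iota^\dagger$. A classical set with $N$ points is $\mathbb C^N$ with normalized trace. Quantum graphs. On $\mathrm{End}(\ell^2(X))$ put $S\star T=\delta^{-2}m(S\otimes T)m^\dagger$ and $T^*=(\mathrm{ev}_X\otimes\mathrm{id})(\mathrm{id}\otimes T^\dagger\otimes\mathrm{id})(\mathrm{id}\otimes\mathrm{coev}_X)$. A quantum graph $(X,\hat T)$ is an operator with $\hat T\star\hat T=\hat T$; irreflexive if $\hat T\star\mathrm{id}=0=\mathrm{id}\star\hat T$, real if $\hat T^*=\hat T$, undirected if $\hat T^\dagger=\hat T$. A classical simple graph is the quantum graph over $\mathbb C^V$ given by its adjacency matrix. For an irreflexive graph the complement is $\hat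 T^c=J-\mathrm{id}-\hat T$. Regularity. $L(\hat T)=(\iota^\dagger\otimes\mathrm{id})(\hat T\otimes\mathrm{id})m^\dagger-\hat T$; connected means $\dim\ker L(\hat T)=1$. Strongly regular with parameters $(n,k,\lambda,\mu)$: $\dim A=n$ and $\hat T^2=\lambda\hat T+\mu\hat T^c+k\,\mathrm{id}$. Put ${}_R\triangle_S^T=(\mathrm{id}\otimes m)(\mathrm{id}\otimes T\otimes\mathrm{id})(m^\dagger\otimes\mathrm{id})(R\otimes S)m^\dagger$ and $\blacktriangle=(\hat T\otimes\hat T)m^\dagger\hat T$. $3$-point regular with parameters $(k,\lambda,\mu,q_3,q_2,q_1,q_0)$: with $T=\hat T$, $C=\hat T^c$, $I=\mathrm{id}$, $$\delta^2\blacktriangle=q_3\,{}_T\triangle_T^T+q_2\left({}_C\triangle_T^T+{}_T\triangle_C^T+{}_T\triangle_T^C\right)+q_1\left({}_C\triangle_C^T+{}_C\triangle_T^C+{}_T\triangle_C^C\right)+q_0\,{}_C\triangle_C^C+\lambda\left({}_T\triangle_T^I+{}_T\triangle_I^T+{}_I\triangle_T^T\right)+\mu\left({}_C\triangle_C^I+{}_C\triangle_I^C+{}_I\triangle_C^C\right)+k\,{}_I\triangle_I^I .$$ (Parameters multiplying a vanishing sum of diagrams are arbitrary; $0$ is listed for them.) Quantum isomorphisms. $(X,\hat T)$ and $(X',\hat T')$ are quantum isomorphic if there are a finite-dimensional Hilbert space $H\ne0$ and a linear map $P:H\otimes\ell^2(X)\to\ell^2(X')\otimes H$ with $(m_{X'}^\dagger\otimes\mathrm{id})P=(\mathrm{id}\otimes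 P)(P\otimes\mathrm{id})(\mathrm{id}_H\otimes m_X^\dagger)$, $(\iota_{X'}^\dagger\otimes\mathrm{id}_H)P=\mathrm{id}_H\otimes\iota_X^\dagger$, $P^\dagger=(\mathrm{ev}_{X'}\otimes\mathrm{id}_H\otimes\mathrm{id}_X)(\mathrm{id}_{X'}\otimes P\otimes\mathrm{id}_X)(\mathrm{id}_{X'}\otimes\mathrm{id}_H\otimes\mathrm{coev}_X)$, $P(\mathrm{id}_H\otimes m_X)=(m_{X'}\otimes\mathrm{id}_H)(\mathrm{id}\otimes P)(P\otimes\mathrm{id})$, $P(\mathrm{id}_H\otimes\iota_X)=\iota_{X'}\otimes\mathrm{id}_H$ and $P(\mathrm{id}_H\otimes\hat T)=(\hat T'\otimes\mathrm{id}_H)P$. The Schläfli graph is the unique strongly regular graph with parameters $(27,16,10,8)$. The Shrikhande graph is the Cayley graph of $\mathbb Z_4\times\mathbb Z_4$ with connection set $\{\pm(1,0),\pm(0,1),\pm(1,-1)\}$. *)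

(* Defs.v *)
From HB Require Import structures.
From mathcomp Require Import all_boot all_order all_algebra.
From mathcomp Require Import complex.
From mathcomp Require Import classical_sets reals.

Set Implicit Arguments.
Unset Strict Implicit.
Unset Printing Implicit Defensive.

Import Order.TTheory GRing.Theory Num.Theory.
Local Open Scope ring_scope.
Local Open Scope complex_scope.
Local Open Scope lfun_scope.

(* Inner products are linear in the second variable. *)
Record hilb (R : realType) := Hilb {
  hsort :> vectType R[i];
  ip : hsort -> hsort -> R[i] }.

Definition is_hilbert (R : realType) (H : hilb R) : Prop :=
  [/\ forall u (a : R[i]) (v w : H), ip u (a *: v + w) = a * ip u v + ip u w,
      forall u v : H, ip v u = Num.conj (ip u v),
      forall u : H, 0 <= ip u u &
      forall u : H, ip u u = 0 -> u = 0].

(* The adjoint is specified by its universal property; it exists and is unique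
   between spaces satisfying [is_hilbert] (the default 0 is then irrelevant). *)
Definition adj (R : realType) (H K : hilb R) (f : 'Hom(H, K)) : 'Hom(K, H) :=
  xget 0 [set g : 'Hom(K, H) |
            forall (u : H) (v : K), ip v (f u) = ip (g v) u]%classic.

Notation "f '^†'" := (adj f) (at level 2, format "f '^†'") : lfun_scope.

Definition hC (R : realType) : hilb R :=
  @Hilb R (R[i])^o (fun a b : R[i] => Num.conj a * b).

(* The tensor product of U and V is modelled by the coordinate matrices of
   tensors in the bases [vbasis fullv] of U and V.  All linear maps below are
   obtained from bilinear ones through [tlift], so they do not depend on these
   bases beyond the choice of the model. *)

Definition tens (R : realType) (U V : hilb R) : hilb R :=
  @Hilb R 'M[R[i]]_(\dim (@fullv _ U), \dim (@fullv _ V))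
    (fun s t => \sum_i \sum_j \sum_k \sum_l
       Num.conj (s i j) * t k l *
       (ip (vbasis (@fullv _ U))`_i (vbasis (@fullv _ U))`_k *
        ip (vbasis (@fullv _ V))`_j (vbasis (@fullv _ V))`_l)).

Definition tpure (R : realType) (U V : hilb R) (u : U) (v : V) : tens U V :=
  \matrix_(i, j) (coord (vbasis (@fullv _ U)) i u *
                  coord (vbasis (@fullv _ V)) j v).

Definition tlift (R : realType) (U V W : hilb R) (b : U -> V -> W) :
    'Hom(tens U V, W) :=
  linfun (fun t : tens U V => \sum_i \sum_j
    (t : 'M_(_, _)) i j *: b (vbasis (@fullv _ U))`_i (vbasis (@fullv _ V))`_j).

Definition tmap (R : realType) (U V U' V' : hilb R)
    (f : 'Hom(U, U')) (g : 'Hom(V, V')) : 'Hom(tens U V, tens U' V') :=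
  tlift (fun u v => tpure (f u) (g v)).

Notation "f ⊗ g" := (tmap f g) (at level 40, left associativity) : lfun_scope.

Definition assoc (R : realType) (U V W : hilb R) :
    'Hom(tens (tens U V) W, tens U (tens V W)) :=
  tlift (fun t w => tlift (fun u v => tpure u (tpure v w)) t).

Definition assocI (R : realType) (U V W : hilb R) :
    'Hom(tens U (tens V W), tens (tens U V) W) :=
  tlift (fun u t => tlift (fun v w => tpure (tpure u v) w) t).

Definition lunit (R : realType) (U : hilb R) : 'Hom(tens (hC R) U, U) :=
  tlift (fun (z : hC R) (u : U) => (z : R[i]) *: u).

Definition lunitI (R : realType) (U : hilb R) : 'Hom(U, tens (hC R) U) :=
  linfun (fun u : U => tpure (1 : hC R) u).

Definition runit (R : realType) (U : hilb R) : 'Hom(tens U (hC R), U) :=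
  tlift (fun (u : U) (z : hC R) => (z : R[i]) *: u).

Definition runitI (R : realType) (U : hilb R) : 'Hom(U, tens U (hC R)) :=
  linfun (fun u : U => tpure u (1 : hC R)).

Arguments assoc {R} U V W.
Arguments assocI {R} U V W.
Arguments lunit {R} U.
Arguments lunitI {R} U.
Arguments runit {R} U.
Arguments runitI {R} U.

(* Raw data; the axioms are in [finite_quantum_set]. *)
Record qset (R : realType) := QSet {
  qsort : vectType R[i];
  qmul : qsort -> qsort -> qsort;
  qone : qsort;
  qstar : qsort -> qsort;
  qstate : qsort -> R[i];
  qdelta : R }.

Section QuantumSets.
Context {R : realType}.
Local Notation C := R[i].

Definition unital_algebra (A : vectType C) (mul : A -> A -> A) (one : A) : Prop :=
  [/\ forall a, linear (mul a),
      forall b, linear (mul^~ b),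
      associative mul, left_id one mul & right_id one mul].

Definition involution (A : vectType C) (mul : A -> A -> A) (star : A -> A) : Prop :=
  [/\ forall (c : C) (a b : A), star (c *: a + b) = Num.conj c *: star a + star b,
      forall a b, star (mul a b) = mul (star b) (star a) &
      involutive star].

(* As usual in MathComp the norm takes its (nonnegative, hence real) values in
   the scalar field.  Completeness is automatic in finite dimension. *)
Definition cstar_norm (A : vectType C) (mul : A -> A -> A) (star : A -> A)
    (N : A -> C) : Prop :=
  [/\ [/\ forall a, 0 <= N a, forall a, N a = 0 -> a = 0,
          forall (c : C) a, N (c *: a) = `|c| * N a &
          forall a b, N (a + b) <= N a + N b],
      forall a b, N (mul a b) <= N a * N b &
      forall a, N (mul (star a) a) = N a ^+ 2].

Definition cstar_algebra (A : vectType C) (mul : A -> A -> A) (one : A)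
    (star : A -> A) : Prop :=
  [/\ unital_algebra mul one, involution mul star &
      exists N : A -> C, cstar_norm mul star N].

Definition faithful_state (A : vectType C) (mul : A -> A -> A) (one : A)
    (star : A -> A) (psi : A -> C) : Prop :=
  [/\ forall (c : C) (a b : A), psi (c *: a + b) = c * psi a + psi b,
      psi one = 1,
      forall a, 0 <= psi (mul (star a) a) &
      forall a, psi (mul (star a) a) = 0 -> a = 0].

Definition l2 (X : qset R) : hilb R :=
  @Hilb R (qsort X) (fun a b => qstate (qmul (qstar a) b)).

Definition qm (X : qset R) : 'Hom(tens (l2 X) (l2 X), l2 X) :=
  @tlift R (l2 X) (l2 X) (l2 X) (@qmul R X).

Definition qi (X : qset R) : 'Hom(hC R, l2 X) :=
  linfun (fun z : hC R => ((z : C) *: qone X : l2 X)).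

Definition dsq (X : qset R) : C := (qdelta X ^+ 2)%:C.

Definition finite_quantum_set (X : qset R) : Prop :=
  [/\ cstar_algebra (@qmul R X) (qone X) (@qstar R X),
      faithful_state (@qmul R X) (qone X) (@qstar R X) (@qstate R X),
      0 < qdelta X &
      qm X \o (qm X)^† = dsq X *: \1].

Definition noncommutative (X : qset R) : Prop :=
  ~ commutative (@qmul R X).

Definition ev (X : qset R) : 'Hom(tens (l2 X) (l2 X), hC R) := (qi X)^† \o qm X.

Definition coev (X : qset R) : 'Hom(hC R, tens (l2 X) (l2 X)) := (qm X)^† \o qi X.

Definition opJ (X : qset R) : 'End(l2 X) := dsq X *: (qi X \o (qi X)^†).

Definition schur (X : qset R) (S T : 'End(l2 X)) : 'End(l2 X) :=
  (dsq X)^-1 *: (qm X \o (S ⊗ T) \o (qm X)^†).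

Definition opstar (X : qset R) (T : 'End(l2 X)) : 'End(l2 X) :=
  lunit _ \o (ev X ⊗ \1) \o assocI _ _ _ \o
  (\1 ⊗ (T^† ⊗ \1)) \o (\1 ⊗ coev X) \o runitI _.

Definition quantum_graph (X : qset R) (T : 'End(l2 X)) : Prop :=
  finite_quantum_set X /\ schur T T = T.

Definition irreflexive_qg (X : qset R) (T : 'End(l2 X)) : Prop :=
  schur T \1 = 0 /\ schur \1 T = 0.

Definition real_qg (X : qset R) (T : 'End(l2 X)) : Prop := opstar T = T.

Definition undirected_qg (X : qset R) (T : 'End(l2 X)) : Prop := T^† = T.

Definition compl_qg (X : qset R) (T : 'End(l2 X)) : 'End(l2 X) := opJ X - \1 - T.

Definition complete_qg (X : qset R) : 'End(l2 X) := opJ X - \1.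

Definition laplacian (X : qset R) (T : 'End(l2 X)) : 'End(l2 X) :=
  lunit _ \o ((qi X)^† ⊗ \1) \o (T ⊗ \1) \o (qm X)^† - T.

Definition connected_qg (X : qset R) (T : 'End(l2 X)) : Prop :=
  \dim (lker (laplacian T)) = 1%N.

(* [compl_qg T] is the complement only when T is irreflexive; this is stated
   separately wherever regularity is used. *)
Definition strongly_regular (X : qset R) (T : 'End(l2 X))
    (n : nat) (k lambda mu : C) : Prop :=
  \dim (@fullv _ (qsort X)) = n /\
  T \o T = lambda *: T + mu *: compl_qg T + k *: \1.

(* [tri A B D] is the triangle with left subscript A, superscript B and right
   subscript D, where B is the edge joining the two output legs. *)
Definition tri (X : qset R) (A B D : 'End(l2 X)) :
    'Hom(l2 X, tens (l2 X) (l2 X)) :=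
  (\1 ⊗ qm X) \o (\1 ⊗ (B ⊗ \1)) \o assoc _ _ _ \o ((qm X)^† ⊗ \1) \o
  (A ⊗ D) \o (qm X)^†.

Definition filled_tri (X : qset R) (T : 'End(l2 X)) :
    'Hom(l2 X, tens (l2 X) (l2 X)) :=
  (T ⊗ T) \o (qm X)^† \o T.

Definition three_point_regular (X : qset R) (T : 'End(l2 X))
    (k lambda mu q3 q2 q1 q0 : C) : Prop :=
  let D := compl_qg T in
  let I := \1 : 'End(l2 X) in
  dsq X *: filled_tri T =
    q3 *: tri T T T
  + q2 *: (tri D T T + tri T D T + tri T T D)
  + q1 *: (tri D D T + tri D T D + tri T D D)
  + q0 *: tri D D D
  + lambda *: (tri T T I + tri T I T + tri I T T)
  + mu *: (tri D D I + tri D I D + tri I D D)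
  + k *: tri I I I.

(* The identities below hold up to the explicit associators and unitors. *)
Definition is_quantum_isomorphism (X X' : qset R)
    (T : 'End(l2 X)) (T' : 'End(l2 X')) (H : hilb R)
    (P : 'Hom(tens H (l2 X), tens (l2 X') H)) : Prop :=
  [/\ (qm X')^† ⊗ \1 \o P =
        assocI _ _ _ \o (\1 ⊗ P) \o assoc _ _ _ \o (P ⊗ \1) \o assocI _ _ _ \o
        (\1 ⊗ (qm X)^†),
      lunit H \o ((qi X')^† ⊗ \1) \o P = runit H \o (\1 ⊗ (qi X)^†),
      P^† = lunit _ \o (ev X' ⊗ \1) \o assocI _ _ _ \o (\1 ⊗ assoc _ _ _) \o
            (\1 ⊗ (P ⊗ \1)) \o (\1 ⊗ assocI _ _ _) \o
            (\1 ⊗ (\1 ⊗ coev X)) \o (\1 ⊗ runitI H) &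
      [/\ P \o (\1 ⊗ qm X) =
            (qm X' ⊗ \1) \o assocI _ _ _ \o (\1 ⊗ P) \o assoc _ _ _ \o
            (P ⊗ \1) \o assocI _ _ _,
          P \o (\1 ⊗ qi X) \o runitI H = (qi X' ⊗ \1) \o lunitI H &
          P \o (\1 ⊗ T) = (T' ⊗ \1) \o P]].

Definition quantum_isomorphic (X X' : qset R)
    (T : 'End(l2 X)) (T' : 'End(l2 X')) : Prop :=
  exists H : hilb R, [/\ is_hilbert H, (0 < \dim (@fullv _ H))%N &
    exists P : 'Hom(tens H (l2 X), tens (l2 X') H),
      is_quantum_isomorphism T T' P].

End QuantumSets.

Arguments noncommutative {R} X.
Arguments complete_qg {R} X.

Definition classical_set (R : realType) (V : finType) : qset R :=
  @QSet R {ffun V -> (R[i])^o}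
    (fun f g => [ffun v => (f v : R[i]) * g v])
    [ffun=> 1]
    (fun f => [ffun v => Num.conj (f v : R[i])])
    (fun f => (\sum_v (f v : R[i])) / #|V|%:R)
    (Num.sqrt #|V|%:R).

Definition adjacency (R : realType) (V : finType) (e : rel V) :
    'End(l2 (classical_set R V)) :=
  linfun (fun f : {ffun V -> (R[i])^o} => [ffun v => \sum_(w | e v w) f w]).

(* The Schlaefli graph is characterized, up to isomorphism, as the simple graph
   with these strong regularity parameters. *)
Definition is_schlafli (R : realType) (V : finType) (e : rel V) : Prop :=
  [/\ symmetric e, irreflexive e &
      strongly_regular (adjacency R e) 27 16%:R 10%:R 8%:R].

Definition shrikhande : rel ('Z_4 * 'Z_4)%type :=
  fun u v => v - u \in
    [:: (1, 0); - (1, 0); (0, 1); - (0, 1); (1, - 1); - (1, - 1)].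

Definition matrix_set (R : realType) (n : nat) : qset R :=
  @QSet R 'M[R[i]]_n
    (fun a b => a *m b)
    1%:M
    (fun a => (map_mx Num.conj a)^T)
    (fun a => \tr a / n%:R)
    n%:R.

(* The linear map sending the matrix unit [delta_mx i j] to [F i j]. *)
Definition linext (R : realType) (n : nat) (F : 'I_n -> 'I_n -> 'M[R[i]]_n) :
    'End(l2 (matrix_set R n)) :=
  linfun (fun a : 'M[R[i]]_n => \sum_i \sum_j a i j *: F i j).

Definition qA3 (R : realType) : 'End(l2 (matrix_set R 2)) :=
  linext (fun i j : 'I_2 =>
    if i == j then 2%:R *: delta_mx (rev_ord i) (rev_ord i) else 0).

Definition qA4 (R : realType) : 'End(l2 (matrix_set R 2)) :=
  complete_qg (matrix_set R 2).

Definition qG3 (R : realType) : 'End(l2 (matrix_set R 3)) :=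
  linext (fun i j : 'I_3 =>
    if i == j then 2%:R *: delta_mx i i else - delta_mx i j).

Definition qG4 (R : realType) : 'End(l2 (matrix_set R 3)) :=
  linext (fun i j : 'I_3 =>
    if i == j then (3%:R / 2%:R) *: \sum_(k | k != i) delta_mx k k
    else (3%:R / 2%:R) *: delta_mx j i).

(* Subtraction of indices is modulo 3; the entries are symmetric under
   exchanging (i, j) and (k, l). *)
Definition q9P (R : realType) : 'End(l2 (matrix_set R 3)) :=
  linext (fun k l : 'I_3 => \sum_i \sum_j
    ((i - j == k - l)%:R + 3%:R * [&& i == j, j == k & k == l]%:R
      - 2%:R * ((i == k) && (j == l))%:R) *: delta_mx i j).

Definition qK9 (R : realType) : 'End(l2 (matrix_set R 3)) :=
  complete_qg (matrix_set R 3).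

(* Main.v *)
(* For M_2 and M_3 the operators are given by rational coefficients in the matrix
   units, so each identity is a finite computation with integer tables.

   For the two classical graphs, let s and t be commuting involutive automorphisms
   of a graph on V, and let S, T be their pullbacks on C^V.  Splitting
   a = a_0 + a_1 into the +1 and -1 eigenvectors of S, the product
   a_0 b + a_1 T(b) turns C^V into a C*-algebra with the same inner product, and the
   adjacency operator into a quantum graph with the same parameters; the twist is
   undone, up to the Pauli matrices, by a quantum isomorphism with a two-dimensional
   H.  The algebra is non-commutative as soon as x, s x and t x are distinct for some
   x.  For the Shrikhande graph, s and t are translations.  The complement of a
   Schlaefli graph is the collinearity graph of a generalized quadrangle with three
   points per line; there the exchange of two non-collinear points x, y extends to a
   reflection, and the reflections for (x, y) and (x, z) commute when z is collinear
   with y but not with x. *)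

From Stdlib Require Import ZArith.
Require Import Defs.
From HB Require Import structures.
From mathcomp Require Import all_boot all_order all_algebra.
From mathcomp Require Import complex.
From mathcomp Require Import boolp classical_sets reals.
From mathcomp Require Import ring lra zify ssrZ.

Set Implicit Arguments.
Unset Strict Implicit.
Unset Printing Implicit Defensive.

Import Order.TTheory GRing.Theory Num.Theory.
Delimit Scope Z_scope with ZZ.
Local Open Scope lfun_scope.
Local Open Scope ring_scope.

(** * Tensor products and adjoints *)

Arguments tens : simpl never.
Arguments hsort : simpl never.
Arguments ip : simpl never.
Arguments hC : simpl never.
Arguments l2 : simpl never.
Arguments tlift : simpl never.
Arguments tpure : simpl never.

(** [adj] is a choice governed by a universal property, so no diagram containing [m^†] evaluates by
    itself: each adjoint is guessed in closed form and verified on orthogonal bases of constant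
    squared norm ([ogb]), a notion stable under tensor products. If [a] has degree [k] under S and
    [b] degree [l] under T, the twisted product is [(-1)^(k l)] times the pointwise one: a 2-cocycle
    deformation for the group [(Z/2)^2]. The quantum isomorphism attaches the Pauli matrix [X^k Z^l]
    to bidegree [(k, l)], and commuting [Z] past [X] produces the same sign. Only S is diagonalized
    below; T stays a permutation of points, so the signs of [Z] appear as shifts by [t]. A Schlaefli
    graph is given by its parameters alone, so its symmetries have to come from counting. The model
    is the Weyl group of E6: non-collinear points are skew lines on a cubic surface, their
    difference is a root, and [x - y], [x - z] are orthogonal roots when [z] meets [y] but not
    [x]. *)

Lemma linfunE_linear (K : fieldType) (U V : vectType K) (f : U -> V) :
  linear f -> linfun f =1 f.
Proof.
move=> lf; pose mf := GRing.isLinear.Build K U V *:%R f lf.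
pose F : {linear U -> V} := HB.pack f mf.
exact: (lfunE F).
Qed.

Lemma linear_scale (K : fieldType) (U V : vectType K) (f : U -> V) a u :
  linear f -> f (a *: u) = a *: f u.
Proof. by move=> lf; rewrite -!(linfunE_linear lf) linearZ. Qed.

Lemma linear_add (K : fieldType) (U V : vectType K) (f : U -> V) u v :
  linear f -> f (u + v) = f u + f v.
Proof. by move=> lf; rewrite -!(linfunE_linear lf) linearD. Qed.

Lemma lfun_sumZ (K : fieldType) (U V : vectType K) (f : 'Hom(U, V)) I (r : seq I)
    (a : I -> K) (F : I -> U) :
  f (\sum_(i <- r) a i *: F i) = \sum_(i <- r) a i *: f (F i).
Proof. by rewrite linear_sum; apply: eq_bigr => i _; rewrite linearZ. Qed.

Lemma vbasis_expand (K : fieldType) (V : vectType K) (v : V) :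
  v = \sum_i coord (vbasis (@fullv _ V)) i v *: (vbasis (@fullv _ V))`_i.
Proof. exact/coord_vbasis/memvf. Qed.

Lemma coord_vbasis_nth (K : fieldType) (V : vectType K) (i j : 'I_(\dim (@fullv _ V))) :
  coord (vbasis (@fullv _ V)) i (vbasis (@fullv _ V))`_j = (i == j)%:R.
Proof. by rewrite coord_free ?(basis_free (vbasisP _)) // eq_sym. Qed.

Section Tensors.
Context {R : realType}.
Local Notation C := R[i].
Implicit Types U V W : hilb R.

Definition bilin U V W (b : U -> V -> W) :=
  (forall u, linear (b u)) /\ (forall v, linear (b^~ v)).

Lemma bilin_suml U V W (b : U -> V -> W) I (r : seq I) (F : I -> U) (a : I -> C) v :
  bilin b -> b (\sum_(i <- r) a i *: F i) v = \sum_(i <- r) a i *: b (F i) v.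
Proof.
case=> _ /(_ v) bl; pose mf := GRing.isLinear.Build _ _ _ *:%R _ bl.
pose f : {linear U -> W} := HB.pack (b^~ v) mf.
rewrite -[LHS]/(f _) linear_sum; apply: eq_bigr => i _; exact: (linearZ_LR f).
Qed.

Lemma bilin_sumr U V W (b : U -> V -> W) I (r : seq I) (F : I -> V) (a : I -> C) u :
  bilin b -> b u (\sum_(i <- r) a i *: F i) = \sum_(i <- r) a i *: b u (F i).
Proof.
case=> /(_ u) bl _; pose mf := GRing.isLinear.Build _ _ _ *:%R _ bl.
pose f : {linear V -> W} := HB.pack (b u) mf.
rewrite -[LHS]/(f _) linear_sum; apply: eq_bigr => i _; exact: (linearZ_LR f).
Qed.

Lemma tlift_sum U V W (b : U -> V -> W) (t : tens U V) :
  tlift b t = \sum_i \sum_j (t : 'M_(_, _)) i j *: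
                b (vbasis (@fullv _ U))`_i (vbasis (@fullv _ V))`_j.
Proof.
rewrite /tlift linfunE_linear // => a r s.
rewrite scaler_sumr -big_split; apply: eq_bigr => i _ /=.
rewrite scaler_sumr -big_split; apply: eq_bigr => j _ /=.
by rewrite !mxE scalerDl scalerA.
Qed.

(** The universal property of the tensor product in the matrix model; after it, maps on tensors are
    only evaluated on pure tensors. *)
Lemma tliftE U V W (b : U -> V -> W) u v : bilin b -> tlift b (tpure u v) = b u v.
Proof.
move=> bb; rewrite tlift_sum.
rewrite [in RHS](vbasis_expand u) bilin_suml //; apply: eq_bigr => i _.
rewrite [in RHS](vbasis_expand v) bilin_sumr // scaler_sumr.
by apply: eq_bigr => j _; rewrite mxE scalerA.
Qed.

Lemma tpure_bilin U V : bilin (@tpure R U V).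
Proof.
split=> [u a v w|v a u w]; apply/matrixP => i j; rewrite !mxE linearP /=.
  by rewrite mulrDr mulrCA.
by rewrite mulrDl mulrA.
Qed.

Lemma tpureZl U V a (u : U) (v : V) : tpure (a *: u) v = a *: tpure u v.
Proof. by apply/matrixP=> i j; rewrite !mxE linearZ /= mulrA. Qed.

Lemma tpureZr U V a (u : U) (v : V) : tpure u (a *: v) = a *: tpure u v.
Proof. by apply/matrixP=> i j; rewrite !mxE linearZ /= mulrCA. Qed.

Lemma tpureDl U V (u u' : U) (v : V) : tpure (u + u') v = tpure u v + tpure u' v.
Proof. by apply/matrixP=> i j; rewrite !mxE linearD /= mulrDl. Qed.

Lemma tpureDr U V (u : U) (v v' : V) : tpure u (v + v') = tpure u v + tpure u v'.
Proof. by apply/matrixP=> i j; rewrite !mxE linearD /= mulrDr. Qed.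

Definition tpureE := (tpureDl, tpureDr, tpureZl, tpureZr).

Lemma tens_expand U V (t : tens U V) :
  t = \sum_i \sum_j (t : 'M_(_, _)) i j *:
        tpure (vbasis (@fullv _ U))`_i (vbasis (@fullv _ V))`_j.
Proof.
apply/matrixP => i j; rewrite !summxE (bigD1 i) //= summxE (bigD1 j) //=.
rewrite !mxE !coord_vbasis_nth !eqxx !mulr1 big1 ?addr0 => [|k kj]; last first.
  by rewrite !mxE !coord_vbasis_nth [j == _]eq_sym (negPf kj) !mulr0.
rewrite big1 ?addr0 // => k ki; rewrite summxE big1 // => l _.
by rewrite !mxE !coord_vbasis_nth [i == _]eq_sym (negPf ki) mul0r mulr0.
Qed.

(** Redundant families are allowed: [homog] below has twice as many members as the dimension. *)
Definition spans (V : vectType C) (I : finType) (e : I -> V) :=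
  forall v, exists a : I -> C, v = \sum_i a i *: e i.

Lemma spans_eq (V W : vectType C) (I : finType) (e : I -> V) (f g : 'Hom(V, W)) :
  spans e -> (forall i, f (e i) = g (e i)) -> f = g.
Proof.
move=> se fg; apply/lfunP => v; have [a ->] := se v.
by rewrite !linear_sum; apply: eq_bigr => i _; rewrite !linearZ /= fg.
Qed.

Lemma spans_tens U V (I J : finType) (e : I -> U) (f : J -> V) :
  spans e -> spans f -> spans (fun p : I * J => tpure (e p.1) (f p.2)).
Proof.
move=> se sf t; rewrite [t]tens_expand.
pose P (x : tens U V) := exists a : I * J -> C, x = \sum_i a i *: tpure (e i.1) (f i.2).
have P0 : P 0 by exists (fun=> 0); rewrite big1 // => i _; rewrite scale0r.
have PD x y : P x -> P y -> P (x + y).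
  move=> [a ->] [b ->]; exists (fun i => a i + b i).
  by rewrite -big_split; apply: eq_bigr => i _; rewrite scalerDl.
have PZ k x : P x -> P (k *: x).
  move=> [a ->]; exists (fun i => k * a i).
  by rewrite scaler_sumr; apply: eq_bigr => i _; rewrite scalerA.
apply: (big_ind P) => // i _; apply: (big_ind P) => // j _; apply: PZ.
have [a ->] := se (vbasis fullv)`_i; have [b ->] := sf (vbasis fullv)`_j.
exists (fun p => a p.1 * b p.2).
rewrite (bilin_suml _ _ _ _ (tpure_bilin U V)).
rewrite -(pair_big xpredT xpredT (fun k l => (a k * b l) *: tpure (e k) (f l))) /=.
apply: eq_bigr => k _; rewrite (bilin_sumr _ _ _ _ (tpure_bilin U V)) scaler_sumr.
by apply: eq_bigr => l _; rewrite scalerA.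
Qed.

Lemma tmapE U V U' V' (f : 'Hom(U, U')) (g : 'Hom(V, V')) u v :
  tmap f g (tpure u v) = tpure (f u) (g v).
Proof.
apply: tliftE; have [bl br] := tpure_bilin U' V'.
by split=> [x a y z|y a x z] /=; rewrite linearP ?bl // (br _ a).
Qed.

Lemma assocE U V W (u : U) (v : V) (w : W) :
  assoc U V W (tpure (tpure u v) w) = tpure u (tpure v w).
Proof.
have bb z : bilin (fun (u : U) (v : V) => tpure u (tpure v z)).
  by split=> [x a y y'|y a x x'] /=; rewrite !tpureE.
rewrite /assoc tliftE ?tliftE //; split=> [t a y z|y a s t] /=; last by rewrite linearP.
rewrite !tlift_sum scaler_sumr -big_split; apply: eq_bigr => i _ /=.
rewrite scaler_sumr -big_split; apply: eq_bigr => j _ /=.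
by rewrite !tpureE scalerDr !scalerA [a * _]mulrC.
Qed.

Lemma assocIE U V W (u : U) (v : V) (w : W) :
  assocI U V W (tpure u (tpure v w)) = tpure (tpure u v) w.
Proof.
have bb x : bilin (fun (v : V) (w : W) => tpure (tpure x v) w).
  by split=> [y a z z'|z a y y'] /=; rewrite !tpureE.
rewrite /assocI tliftE ?tliftE //; split=> [x a s t|t a x y] /=; first by rewrite linearP.
rewrite !tlift_sum scaler_sumr -big_split; apply: eq_bigr => i _ /=.
rewrite scaler_sumr -big_split; apply: eq_bigr => j _ /=.
by rewrite !tpureE scalerDr !scalerA [a * _]mulrC.
Qed.

Lemma lunitE U (z : hC R) (u : U) : lunit U (tpure z u) = (z : C) *: u.
Proof.
rewrite /lunit tliftE //; split=> [x a y y'|y a x x'] /=; last by rewrite scalerDl scalerA.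
by rewrite scalerDr !scalerA mulrC.
Qed.

Lemma runitE U (u : U) (z : hC R) : runit U (tpure u z) = (z : C) *: u.
Proof.
rewrite /runit tliftE //; split=> [x a y y'|y a x x'] /=; first by rewrite scalerDl scalerA.
by rewrite scalerDr !scalerA mulrC.
Qed.

Lemma lunitIE U (u : U) : lunitI U u = tpure (1 : hC R) u.
Proof. by rewrite /lunitI linfunE_linear //; apply: (tpure_bilin _ _).1. Qed.

Lemma runitIE U (u : U) : runitI U u = tpure u (1 : hC R).
Proof. by rewrite /runitI linfunE_linear //; apply: (tpure_bilin _ _).2. Qed.

Lemma tpure_suml U V I (r : seq I) (F : I -> U) (a : I -> C) (v : V) :
  tpure (\sum_(i <- r) a i *: F i) v = \sum_(i <- r) a i *: tpure (F i) v.
Proof. exact: (bilin_suml _ _ _ _ (tpure_bilin U V)). Qed.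

Lemma tpure_sumr U V I (r : seq I) (F : I -> V) (a : I -> C) (u : U) :
  tpure u (\sum_(i <- r) a i *: F i) = \sum_(i <- r) a i *: tpure u (F i).
Proof. exact: (bilin_sumr _ _ _ _ (tpure_bilin U V)). Qed.

(** The basis is left unnormalized, which avoids square roots: for normalized traces [c] is [1/n] on
    matrix units and [1/|V|] on Dirac functions. *)
Definition ogb (H : hilb R) (I : finType) (e : I -> H) (c : C) :=
  [/\ forall u (a : C) (v w : H), ip u (a *: v + w) = a * ip u v + ip u w,
      forall u v : H, ip v u = Num.conj (ip u v),
      0 < c, forall i j, ip (e i) (e j) = c *+ (i == j) & spans e].

Section Orthogonal.
Variables (H : hilb R) (I : finType) (e : I -> H) (c : C).
Hypothesis oe : ogb e c.

Lemma ogb_ip_sumr J (r : seq J) (a : J -> C) (F : J -> H) u :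
  ip u (\sum_(j <- r) a j *: F j) = \sum_(j <- r) a j * ip u (F j).
Proof.
have [lin _ _ _ _] := oe.
have z0 : ip u (0 : H) = 0.
  by have := lin u 1 0 0; rewrite scale1r addr0 mul1r => /esym/eqP; rewrite -subr_eq0 addrK => /eqP.
by elim: r => [|j r IH]; rewrite ?big_nil // !big_cons lin IH.
Qed.

Lemma ogb_ip_suml J (r : seq J) (a : J -> C) (F : J -> H) u :
  ip (\sum_(j <- r) a j *: F j) u = \sum_(j <- r) Num.conj (a j) * ip (F j) u.
Proof.
have [_ cj _ _ _] := oe.
rewrite cj ogb_ip_sumr rmorph_sum; apply: eq_bigr => j _.
by rewrite rmorphM /= -cj.
Qed.

Lemma ogb_expand v : v = \sum_i (ip (e i) v / c) *: e i.
Proof.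
have [_ _ c0 o s] := oe; have [a ->] := s v.
apply: eq_bigr => i _; congr (_ *: _); rewrite ogb_ip_sumr (bigD1 i) //= big1.
  by rewrite addr0 o eqxx mulr1n mulfK // gt_eqF.
by move=> j ji; rewrite o eq_sym (negPf ji) mulr0.
Qed.

Lemma ogb_eq u v : (forall i, ip (e i) u = ip (e i) v) -> u = v.
Proof.
by move=> uv; rewrite [u]ogb_expand [v]ogb_expand; apply: eq_bigr => i _; rewrite uv.
Qed.

Lemma ogb_norm v : ip v v = \sum_i `|ip (e i) v| ^+ 2 / c.
Proof.
have [_ cj c0 o s] := oe; rewrite {2}[v]ogb_expand ogb_ip_sumr.
by apply: eq_bigr => i _; rewrite [ip v _]cj normCK mulrAC.
Qed.

(** Positivity and definiteness are read off Parseval's formula [ogb_norm]. *)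
Lemma ogb_hilbert : is_hilbert H.
Proof.
have [lin cj c0 o s] := oe; split => // [u|u u0].
  by rewrite ogb_norm sumr_ge0 // => i _; rewrite divr_ge0 ?exprn_ge0 ?normr_ge0 // ltW.
rewrite [u]ogb_expand big1 // => i _.
have: \sum_i `|ip (e i) u| ^+ 2 / c == 0 by rewrite -ogb_norm u0.
rewrite psumr_eq0 => [/allP/(_ i)|j _]; last by rewrite divr_ge0 ?exprn_ge0 ?normr_ge0 // ltW.
rewrite mem_index_enum => /(_ isT); rewrite mulf_eq0 invr_eq0 [c == 0]gt_eqF // orbF.
by rewrite expf_eq0 normr_eq0 => /eqP ->; rewrite mul0r scale0r.
Qed.

End Orthogonal.

(** Sesquilinearity extends the identity from the spanning families to all vectors, so [S] satisfies
    the property that [adj] selects by; non-degeneracy leaves no other candidate. The spanning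
    families are separate from the orthogonal bases because [isoP_adj] tests on homogeneous vectors,
    which are redundant. *)
Lemma adj_eq_spans (H K : hilb R) (I J I' J' : finType) (e : I -> H) (f : J -> K) c d
    (e' : I' -> H) (f' : J' -> K) (T : 'Hom(H, K)) (S : 'Hom(K, H)) :
  ogb e c -> ogb f d -> spans e' -> spans f' ->
  (forall i j, ip (f' j) (T (e' i)) = ip (S (f' j)) (e' i)) -> adj T = S.
Proof.
move=> oe og se sf TS.
have TS' u v : ip v (T u) = ip (S v) u.
  have [a ->] := se u; have [b ->] := sf v; rewrite !lfun_sumZ.
  rewrite (ogb_ip_sumr og) (ogb_ip_sumr oe); apply: eq_bigr => i _; congr (_ * _).
  by rewrite (ogb_ip_suml og) (ogb_ip_suml oe); apply: eq_bigr => j _; rewrite TS.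
rewrite /adj; case: xgetP => [g -> gP|/(_ S)]; last by case.
apply/lfunP => v; have [_ cj _ _ _] := oe; apply: (ogb_eq oe) => i.
by rewrite cj -gP TS' -cj.
Qed.

Lemma adj_eq (H K : hilb R) (I J : finType) (e : I -> H) (f : J -> K) c d
    (T : 'Hom(H, K)) (S : 'Hom(K, H)) : ogb e c -> ogb f d ->
  (forall i j, ip (f j) (T (e i)) = ip (S (f j)) (e i)) -> adj T = S.
Proof.
by move=> oe og; apply: (adj_eq_spans oe og); [have [] := oe | have [] := og].
Qed.

Lemma ip_tens (H K : hilb R) (I J : finType) (e : I -> H) (f : J -> K) c d u v u' v' :
  ogb e c -> ogb f d ->
  ip (tpure u v : tens H K) (tpure u' v') = ip u u' * ip v v'.
Proof.
move=> oe og; rewrite {2}[u]vbasis_expand {2}[u']vbasis_expand.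
rewrite {2}[v]vbasis_expand {2}[v']vbasis_expand.
rewrite (ogb_ip_suml oe) (ogb_ip_suml og) mulr_suml /=; apply: eq_bigr => i _.
rewrite mulr_sumr; apply: eq_bigr => j _.
rewrite (ogb_ip_sumr oe) (ogb_ip_sumr og) mulr_sumr mulr_suml; apply: eq_bigr => k _.
rewrite mulr_sumr mulr_sumr; apply: eq_bigr => l _.
by rewrite !mxE rmorphM /=; ring.
Qed.

Lemma exchange_big4 (I J K L : finType) (F : I -> J -> K -> L -> C) :
  \sum_i \sum_j \sum_k \sum_l F i j k l = \sum_k \sum_l \sum_i \sum_j F i j k l.
Proof.
rewrite pair_big exchange_big /=; apply: eq_bigr => k _.
by rewrite exchange_big /=; apply: eq_bigr => l _; rewrite pair_big.
Qed.

Lemma ogb_tens (H K : hilb R) (I J : finType) (e : I -> H) (f : J -> K) c d :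
  ogb e c -> ogb f d ->
  ogb (fun p : I * J => tpure (e p.1) (f p.2) : tens H K) (c * d).
Proof.
move=> oe og; have [_ cje c0 oije se] := oe; have [_ cjf d0 oijf sf] := og.
split; rewrite ?mulr_gt0 //; last exact: spans_tens.
- move=> s a t t'; rewrite /ip /= mulr_sumr -big_split; apply: eq_bigr => i _ /=.
  rewrite mulr_sumr -big_split; apply: eq_bigr => j _ /=.
  rewrite mulr_sumr -big_split; apply: eq_bigr => k _ /=.
  rewrite mulr_sumr -big_split; apply: eq_bigr => l _ /=.
  by rewrite !mxE mulrDr mulrDl; congr (_ + _); rewrite !mulrA [a * _]mulrC.
- move=> s t; rewrite /ip /= exchange_big4 rmorph_sum; apply: eq_bigr => i _.
  rewrite rmorph_sum; apply: eq_bigr => j _; rewrite rmorph_sum; apply: eq_bigr => k _.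
  rewrite rmorph_sum; apply: eq_bigr => l _.
  by rewrite !rmorphM /= conjCK -cje -cjf [_ * s _ _]mulrC.
- move=> [i j] [k l]; rewrite (ip_tens _ _ _ _ oe og) /= oije oijf xpair_eqE.
  by case: (i == k); case: (j == l); rewrite ?mulr0n ?mulr1n ?mulr0 ?mul0r.
Qed.

End Tensors.

(** * The C*-norm of a finite quantum set *)

Section HilbertNorm.
Context {R : realType} (H : hilb R).
Hypothesis hH : is_hilbert H.
Local Notation C := R[i].
Implicit Types u v w : H.

Let lin u (a : C) v w : ip u (a *: v + w) = a * ip u v + ip u w.
Proof. by have [] := hH. Qed.

Let cj u v : ip v u = Num.conj (ip u v).
Proof. by have [] := hH. Qed.

Lemma ipZr u (a : C) v : ip u (a *: v) = a * ip u v.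
Proof.
have z0 : ip u (0 : H) = 0.
  by have := lin u 1 0 0; rewrite scale1r addr0 mul1r => /esym/eqP; rewrite -subr_eq0 addrK => /eqP.
by rewrite -[a *: v]addr0 lin z0 addr0.
Qed.

Lemma ipDr u v w : ip u (v + w) = ip u v + ip u w.
Proof. by rewrite -[v]scale1r lin scale1r mul1r. Qed.

Lemma ipZl u (a : C) v : ip (a *: v) u = Num.conj a * ip v u.
Proof. by rewrite cj ipZr rmorphM /= -cj. Qed.

Lemma ipDl u v w : ip (v + w) u = ip v u + ip w u.
Proof. by rewrite cj ipDr rmorphD /= -!cj. Qed.

Lemma ip_ge0 u : 0 <= ip u u.
Proof. by have [] := hH. Qed.

Definition hnorm u : C := sqrtC (ip u u).

Lemma hnorm_ge0 u : 0 <= hnorm u.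
Proof. by rewrite sqrtC_ge0 ip_ge0. Qed.

Lemma hnorm_sq u : hnorm u ^+ 2 = ip u u.
Proof. exact: sqrtCK. Qed.

Lemma hnorm0 : hnorm 0 = 0.
Proof. by rewrite /hnorm -[0 : H](scale0r (0 : H)) ipZr mul0r sqrtC0. Qed.

Lemma hnorm_eq0 u : hnorm u = 0 -> u = 0.
Proof.
move/eqP; rewrite sqrtC_eq0 => /eqP; by have [_ _ _] := hH; apply.
Qed.

Lemma hnormZ a u : hnorm (a *: u) = `|a| * hnorm u.
Proof.
apply/eqP; rewrite -(@eqrXn2 _ 2) ?mulr_ge0 ?normr_ge0 ?hnorm_ge0 //.
by rewrite exprMn !hnorm_sq ipZl ipZr mulrA mulrC normCK [a * _]mulrC mulrC.
Qed.

Lemma cauchy_schwarz u v : `|ip u v| <= hnorm u * hnorm v.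
Proof.
have [->|v0] := eqVneq v 0.
  by rewrite -[0 : H](scale0r (0 : H)) ipZr mul0r normr0 scale0r hnorm0 mulr0.
have vv0 : 0 < ip v v.
  rewrite lt_def ip_ge0 andbT; apply: contraNneq v0 => vv; apply/eqP.
  by have [_ _ _] := hH; apply.
have vr : Num.conj (ip v v) = ip v v by rewrite -cj.
rewrite -(@ler_pXn2r _ 2) ?nnegrE ?mulr_ge0 ?normr_ge0 ?hnorm_ge0 //.
rewrite exprMn !hnorm_sq.
(* The squared norm of the component of [u] orthogonal to [v]. *)
have := ip_ge0 (u + - (ip v u / ip v v) *: v).
rewrite ipDl !ipDr !ipZl !ipZr.
have -> : Num.conj (- (ip v u / ip v v)) = - (ip u v / ip v v) :> C.
    by rewrite -[in RHS]vr [in RHS](cj v u) -fmorphV -rmorphM -rmorphN.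
set x := ip u u; set y := ip v v; set a := ip u v; set b := ip v u.
have -> : x + - (b / y) * a + (- (a / y) * b + - (a / y) * (- (b / y) * y)) = x - a * b / y.
  by field; rewrite gt_eqF.
by rewrite subr_ge0 ler_pdivrMr // normCK -/a -[Num.conj a]cj.
Qed.

Lemma hnormD u v : hnorm (u + v) <= hnorm u + hnorm v.
Proof.
rewrite -(@ler_pXn2r _ 2) ?nnegrE ?addr_ge0 ?hnorm_ge0 //.
rewrite sqrrD !hnorm_sq ipDl !ipDr addrA -(addrA (ip u u)) lerD2r lerD2l (cj u v).
have cr : ip u v + Num.conj (ip u v) \is Num.real.
  by rewrite CrealE rmorphD /= conjCK addrC.
apply: le_trans (real_ler_norm cr) _; apply: le_trans (ler_normD _ _) _.
by rewrite norm_conjC -mulr2n lerMn2r cauchy_schwarz.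
Qed.

Lemma hnorm_sum I (r : seq I) (a : I -> C) (F : I -> H) :
  hnorm (\sum_(i <- r) a i *: F i) <= \sum_(i <- r) `|a i| * hnorm (F i).
Proof.
elim: r => [|i r IH]; first by rewrite !big_nil hnorm0.
by rewrite !big_cons; apply: le_trans (hnormD _ _) _; rewrite hnormZ lerD2l.
Qed.

End HilbertNorm.

Section OperatorNorm.
Context {R : realType} (H : hilb R).
Local Notation C := R[i].

Lemma operator_norm_exists (I : finType) (e : I -> H) c (f : H -> H) :
    ogb e c -> linear f ->
  exists N : C, [/\ 0 <= N, forall v, hnorm (f v) <= N * hnorm v &
    forall K : C, 0 <= K -> (forall v, hnorm (f v) <= K * hnorm v) -> N <= K].
Proof.
move=> oe lf; have hH := ogb_hilbert oe; have [_ _ c0 _ _] := oe.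
have f_sum (a : I -> C) : f (\sum_i a i *: e i) = \sum_i a i *: f (e i).
  by rewrite -!(linfunE_linear lf) lfun_sumZ; apply: eq_bigr => i _; rewrite linfunE_linear.
have f0 : f 0 = 0 by rewrite -(linfunE_linear lf) linear0.
have toR (x : C) : 0 <= x -> ((complex.Re x)%:C)%C = x.
  by move=> /ger0_real/RRe_real.
(* The bounds are collected in [R], where infima exist; the norm itself takes values in [R[i]]. *)
pose S := [set K : R | 0 <= K /\ forall v, hnorm (f v) <= (K%:C)%C * hnorm v]%classic.
have S0 : (S !=set0)%classic.
  (* A crude bound: expand [v] in the basis and estimate each coordinate by Cauchy-Schwarz. *)
  pose B := \sum_i hnorm (e i) / c * hnorm (f (e i)).
  have B0 : 0 <= B.
    apply: sumr_ge0 => i _; rewrite mulr_ge0 ?hnorm_ge0 // divr_ge0 ?hnorm_ge0 //.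
    exact: ltW.
  exists (complex.Re B); split; first by rewrite -ler0c toR.
  move=> v; rewrite toR // {1}(ogb_expand oe v) f_sum.
  apply: le_trans (hnorm_sum hH _ _ _) _; rewrite mulr_suml; apply: ler_sum => i _.
  rewrite [X in _ <= X]mulrAC ler_wpM2r ?hnorm_ge0 // normrM normfV (gtr0_norm c0).
  by rewrite [X in _ <= X]mulrAC ler_wpM2r ?invr_ge0 ?(ltW c0) // cauchy_schwarz.
have Slb : (lbound S 0)%classic by move=> K [].
have N0 : 0 <= inf S by apply: lb_le_inf.
exists ((inf S)%:C)%C; split; first by rewrite ler0c.
  move=> v; have [->|v0] := eqVneq v 0; first by rewrite f0 hnorm0 // mulr0.
  have v1 : 0 < hnorm v.
    rewrite lt_def hnorm_ge0 // andbT; apply: contraNneq v0 => /hnorm_eq0 -> //.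
  rewrite -ler_pdivrMr // -[X in X <= _]toR ?divr_ge0 ?hnorm_ge0 // lecR.
  apply: lb_le_inf => // K [K0 /(_ v)]; rewrite -ler_pdivrMr // => Kv.
  by rewrite -lecR toR // divr_ge0 ?hnorm_ge0.
move=> K K0 Kb; rewrite -[K]toR // lecR; apply: ge_inf; first by exists 0.
by split=> [|v]; rewrite ?toR // -ler0c toR.
Qed.

End OperatorNorm.

Section CstarNorm.
Context {R : realType} (X : qset R).
Local Notation C := R[i].

(* The norm is the operator norm of the left regular representation on [l2 X]. *)
Lemma cstar_norm_exists (I : finType) (e : I -> l2 X) c : ogb e c ->
    unital_algebra (@qmul R X) (qone X) -> involution (@qmul R X) (@qstar R X) ->
  exists N : qsort X -> C, cstar_norm (@qmul R X) (@qstar R X) N.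
Proof.
move=> oe [mulr mull mA m1l m1r] [starP starM starK]; have hH := ogb_hilbert oe.
have ipM a (b d : l2 X) : ip (qmul a b : l2 X) d = ip b (qmul (qstar a) d : l2 X).
  by rewrite /ip /= starM mA.
have N_ex a : exists N : C, [/\ 0 <= N,
    forall v : l2 X, hnorm (qmul a v : l2 X) <= N * hnorm v &
    forall K : C, 0 <= K -> (forall v : l2 X, hnorm (qmul a v : l2 X) <= K * hnorm v) -> N <= K].
  exact: (operator_norm_exists oe (mulr a)).
have [N NP] := choice N_ex; exists N.
have N0 a : 0 <= N a by have [] := NP a.
have Nb a (v : l2 X) : hnorm (qmul a v : l2 X) <= N a * hnorm v by have [] := NP a.
have Nmin a (K : C) : 0 <= K ->
  (forall v : l2 X, hnorm (qmul a v : l2 X) <= K * hnorm v) -> N a <= K.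
  by have [_ _] := NP a; apply.
have mulZl k (a b : qsort X) : qmul (k *: a) b = k *: qmul a b.
  exact: linear_scale k a (mull b).
have mulDl (a a' b : qsort X) : qmul (a + a') b = qmul a b + qmul a' b.
  exact: linear_add a a' (mull b).
have NM a b : N (qmul a b) <= N a * N b.
  apply: Nmin => [|v]; first exact: mulr_ge0.
  rewrite -mA; apply: le_trans (Nb _ _) _.
  by rewrite -mulrA ler_wpM2l.
have NZ k a : N (k *: a) <= `|k| * N a.
  apply: Nmin => [|v]; first exact: mulr_ge0.
  by rewrite mulZl hnormZ // -mulrA ler_wpM2l.
(* The squared norm of [a v] is the inner product of [v] with [a^* a v], hence at most [N (a^* a)]
   times the squared norm of [v]. *)
have Nsq a : N a ^+ 2 <= N (qmul (qstar a) a).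
  rewrite -[X in _ <= X]sqrtCK ler_pXn2r ?nnegrE ?sqrtC_ge0 //.
  apply: Nmin => [|v]; first by rewrite sqrtC_ge0.
  rewrite -(@ler_pXn2r _ 2) ?nnegrE ?mulr_ge0 ?hnorm_ge0 ?sqrtC_ge0 //.
  rewrite exprMn sqrtCK hnorm_sq // ipM mA -[X in X <= _]ger0_norm; last first.
    by rewrite -mA -ipM ip_ge0.
  apply: le_trans (cauchy_schwarz hH _ _) _.
  by rewrite sqrtCK -[ip v v]hnorm_sq // expr2 mulrCA ler_wpM2l ?hnorm_ge0 // Nb.
have Nstar_le a : N a <= N (qstar a).
  have [->|a0] := eqVneq (N a) 0; first exact: N0.
  have Na : 0 < N a by rewrite lt_def a0 N0.
  by rewrite -(ler_pM2r Na) -expr2; apply: le_trans (Nsq a) (NM _ _).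
have Nstar a : N (qstar a) = N a.
  by apply/le_anti; rewrite Nstar_le andbT -{2}[a]starK Nstar_le.
split; last 2 first.
- exact: NM.
- by move=> a; apply/le_anti; rewrite Nsq andbT; apply: le_trans (NM _ _) _; rewrite Nstar expr2.
split=> //.
- move=> a Na0; have := Nb a (qone X); rewrite m1r Na0 mul0r => ha.
  by apply: (@hnorm_eq0 _ (l2 X) hH); apply/le_anti; rewrite ha hnorm_ge0.
- move=> k a; apply/le_anti; rewrite NZ /=.
  have [->|k0] := eqVneq k 0; first by rewrite normr0 mul0r.
  rewrite mulrC -ler_pdivlMr ?normr_gt0 // mulrC -normfV.
  by rewrite -{1}[a](scalerK k0); apply: NZ.
- move=> a b; apply: Nmin => [|v]; first exact: addr_ge0.
  rewrite mulDl mulrDl; apply: le_trans (hnormD hH _ _) _.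
  by apply: lerD.
Qed.

End CstarNorm.

(** * Finite quantum sets; matrix algebras *)

Section QuantumSetCalculus.
Context {R : realType} (X : qset R).
Local Notation C := R[i].

Lemma ogb_hC : @ogb R (hC R) unit (fun=> 1 : R[i]) 1.
Proof.
split=> // [u a v w|u v|[] []|v]; rewrite /ip /=.
- by rewrite mulrDr mulrCA.
- by rewrite rmorphM /= conjCK mulrC.
- by rewrite conjC1 mulr1.
by exists (fun=> v); rewrite big_const card_unit /= addr0 [RHS]mulr1.
Qed.

Variables (I : finType) (e : I -> l2 X) (c : C).
Hypothesis oe : ogb e c.
Hypothesis algX : unital_algebra (@qmul R X) (qone X).
Hypothesis starX : involution (@qmul R X) (@qstar R X).

Lemma qmul_bilin : @bilin R (l2 X) (l2 X) (l2 X) (@qmul R X).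
Proof. by have [? ? _ _ _] := algX. Qed.

Lemma qmE (a b : l2 X) : qm X (tpure a b) = qmul a b.
Proof. exact: tliftE qmul_bilin. Qed.

Lemma qiE (z : hC R) : qi X z = (z : C) *: (qone X : l2 X).
Proof.
by apply: linfunE_linear => k u v; rewrite scalerDl scalerA.
Qed.

Lemma qstar1 : qstar (qone X) = qone X.
Proof.
have [_ _ _ m1l m1r] := algX; have [_ starM starK] := starX.
by rewrite -[LHS]m1l -{1}[qone X]starK -starM m1l starK.
Qed.

Lemma ip_one (a : l2 X) : ip (qone X : l2 X) a = qstate a.
Proof. by have [_ _ _ m1l _] := algX; rewrite /ip /= qstar1 m1l. Qed.

Lemma qi_adjE (a : l2 X) : (qi X)^† a = qstate a.
Proof.
have hX := ogb_hilbert oe.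
have lpsi : linear (fun a : l2 X => qstate a : hC R).
  by move=> k u v; rewrite -!ip_one ipDr // ipZr.
rewrite (adj_eq (S := linfun (fun a : l2 X => qstate a : hC R)) ogb_hC oe).
  by rewrite linfunE_linear.
  move=> [] i; rewrite qiE scale1r linfunE_linear // [RHS]/ip /= mulr1.
by rewrite -ip_one; have [_ cj _ _] := hX; rewrite -cj.
Qed.

Lemma opJE (a : l2 X) : opJ X a = (dsq X * qstate a) *: (qone X : l2 X).
Proof. by rewrite /opJ scale_lfunE comp_lfunE qi_adjE qiE scalerA. Qed.

Lemma compl_qgE (T : 'End(l2 X)) (a : l2 X) :
  compl_qg T a = (dsq X * qstate a) *: (qone X : l2 X) - a - T a.
Proof. by rewrite /compl_qg !add_lfunE !opp_lfunE opJE id_lfunE. Qed.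

(** Faithfulness of the state is definiteness of the inner product, and the C*-norm comes from the
    regular representation; what remains is a formula [D] for the adjoint of the multiplication. *)
Lemma finite_quantum_setP (D : 'Hom(l2 X, tens (l2 X) (l2 X))) :
    qstate (qone X) = 1 -> 0 < qdelta X ->
    (qm X)^† = D -> (forall a, qm X (D a) = dsq X *: a) ->
  finite_quantum_set X.
Proof.
move=> psi1 d0 mD mD'; have hX := ogb_hilbert oe.
split=> //; first by split=> //; apply: cstar_norm_exists oe _ _.
  split=> //.
  - by move=> k a b; rewrite -!ip_one (@ipDr R (l2 X)) // ipZr.
  - by move=> a; apply: (ip_ge0 hX a).
  - by move=> a; have [_ _ _] := hX; apply.
by rewrite mD; apply/lfunP => a; rewrite comp_lfunE mD' scale_lfunE id_lfunE.
Qed.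

End QuantumSetCalculus.

(** * Matrix algebras with the normalized trace *)

Section MatrixSet.
Context {R : realType} (n' : nat).
Local Notation n := n'.+1.
Local Notation C := R[i].
Local Notation X := (matrix_set R n).
Local Notation M := (l2 X).
Local Notation E i j := (delta_mx i j : M).

Let n0 : (n%:R : C) != 0.
Proof. by rewrite pnatr_eq0. Qed.

Lemma matrix_set_algebra : unital_algebra (@qmul R X) (qone X).
Proof.
split=> /= [a k b d|b k a d|a b d|a|a]; rewrite ?mul1mx ?mulmx1 //.
- by rewrite mulmxDr -scalemxAr.
- by rewrite mulmxDl -scalemxAl.
- exact: mulmxA.
Qed.

Lemma matrix_set_involution : involution (@qmul R X) (@qstar R X).
Proof.
split=> /= [k a b|a b|a].
- by apply/matrixP=> i j; rewrite !mxE rmorphD rmorphM.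
- by rewrite map_mxM trmx_mul.
- by apply/matrixP=> i j; rewrite !mxE conjCK.
Qed.

Lemma ip_delta i j (a : M) : ip (E i j) a = (a : 'M_n) i j / n%:R.
Proof.
rewrite /ip /=; congr (_ / _).
rewrite /mxtrace (bigD1 j) //= !mxE (bigD1 i) //= !mxE !eqxx conjC1 mul1r.
rewrite !big1 ?addr0 // => [k kj|k ki]; rewrite !mxE.
  by rewrite big1 // => l _; rewrite !mxE (negPf kj) andbF rmorph0 mul0r.
by rewrite (negPf ki) rmorph0 mul0r.
Qed.

Lemma matrix_ogb : @ogb R M ('I_n * 'I_n)%type (fun p => E p.1 p.2) n%:R^-1.
Proof.
split=> // [u a v w|u v||[i j] [k l]|v].
- by rewrite /ip /= mulmxDr -scalemxAr mxtraceD mxtraceZ mulrDl mulrA.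
- rewrite /ip /= rmorphM fmorphV /= conjC_nat; congr (_ / _).
  rewrite -mxtrace_tr trmx_mul trmxK /mxtrace rmorph_sum; apply: eq_bigr => i _.
  rewrite !mxE rmorph_sum; apply: eq_bigr => j _.
  by rewrite !mxE rmorphM /= conjCK mulrC.
- by rewrite invr_gt0 ltr0n.
- by rewrite ip_delta mxE xpair_eqE mulr_natl.
exists (fun p => (v : 'M_n) p.1 p.2).
by rewrite {1}[v](matrix_sum_delta (v : 'M_n)) pair_big.
Qed.

Let qmE' := qmE matrix_set_algebra.

Lemma delta_mul i j k l : qm X (tpure (E i j) (E k l)) = (j == k)%:R *: E i l.
Proof. by rewrite qmE' /= mul_delta_mx_cond scaler_nat. Qed.

(** The factor [n] compensates for the squared norm [1/n] of a matrix unit: two of them are paired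
    on the tensor side and one on the other. *)
Definition mdag : 'Hom(M, tens M M) :=
  linfun (fun a : 'M_n => \sum_i \sum_j a i j *:
     (\sum_k n%:R *: tpure (E i k) (E k j)) : tens M M).

Lemma linfun_delta_sum (V : vectType C) (F : 'I_n -> 'I_n -> V) i j :
  (linfun (fun a : 'M[C]_n => \sum_i \sum_j a i j *: F i j) : 'Hom(M, V)) (E i j) = F i j.
Proof.
rewrite linfunE_linear; last first.
  move=> a u v; rewrite scaler_sumr -big_split; apply: eq_bigr => k _ /=.
  rewrite scaler_sumr -big_split; apply: eq_bigr => l _ /=.
  by rewrite !mxE scalerDl scalerA.
rewrite (bigD1 i) //= (bigD1 j) //= !mxE !eqxx scale1r !big1 ?addr0 //.
  move=> k ki; rewrite big1 // => l _; by rewrite !mxE (negPf ki) scale0r.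
by move=> l lj; rewrite !mxE (negPf lj) andbF scale0r.
Qed.

Lemma mdagE i j : mdag (E i j) = \sum_k n%:R *: tpure (E i k) (E k j).
Proof. exact: linfun_delta_sum. Qed.

Lemma qm_adj : (qm X)^† = mdag.
Proof.
apply: (adj_eq (ogb_tens matrix_ogb matrix_ogb) matrix_ogb) => -[[i j] [k l]] [p q] /=.
rewrite mdagE (ogb_ip_suml (ogb_tens matrix_ogb matrix_ogb)) delta_mul.
under eq_bigr do rewrite (ip_tens _ _ _ _ matrix_ogb matrix_ogb) !ip_delta !mxE.
rewrite ip_delta !mxE (bigD1 j) //= big1 ?addr0 => [|m mj].
  rewrite eqxx conjC_nat andbT [j == k]eq_sym.
  case: (p == i); case: (q == l); case: (k == j);
    rewrite ?mulr0 ?mul0r ?mulr1 ?mul1r //= ?andbF ?mulr0 ?mul0r //.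
  by rewrite mulrA mulfV // mul1r.
by rewrite [m == j](negPf mj) andbF !mul0r mulr0.
Qed.

Lemma dsqE : dsq X = n%:R ^+ 2.
Proof. by rewrite /dsq /= rmorphXn rmorph_nat. Qed.

Lemma spans_delta : spans (fun p : 'I_n * 'I_n => E p.1 p.2).
Proof. by have [] := matrix_ogb. Qed.

Lemma matrix_lfun_eq (V : vectType C) (f g : 'Hom(M, V)) :
  (forall i j, f (E i j) = g (E i j)) -> f = g.
Proof. by move=> fg; apply: (spans_eq spans_delta) => -[i j]. Qed.

Lemma qm_mdag a : qm X (mdag a) = dsq X *: a.
Proof.
have: qm X \o mdag = dsq X *: \1.
  apply: matrix_lfun_eq => i j; rewrite comp_lfunE scale_lfunE id_lfunE mdagE lfun_sumZ.
  under eq_bigr do rewrite delta_mul eqxx scale1r.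
  by rewrite sumr_const card_ord dsqE -scaler_nat scalerA.
by move/(congr1 (fun f : 'End(M) => f a)); rewrite comp_lfunE scale_lfunE id_lfunE.
Qed.

Lemma matrix_finite_quantum_set : finite_quantum_set X.
Proof.
apply: (finite_quantum_setP matrix_ogb matrix_set_algebra matrix_set_involution _ _ qm_adj qm_mdag).
  by rewrite /= mxtrace1 divff.
by rewrite /= ltr0n.
Qed.

End MatrixSet.

(** * Operators on matrix algebras *)

Lemma sum_scale1 (K : fieldType) (V : vectType K) I (l : seq I) (F : I -> V) :
  \sum_(i <- l) F i = \sum_(i <- l) 1 *: F i.
Proof. by apply: eq_bigr => k _; rewrite scale1r. Qed.

Section MatrixOperators.
Context {R : realType} (n' : nat).
Local Notation n := n'.+1.
Local Notation C := R[i].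
Local Notation X := (matrix_set R n).
Local Notation M := (l2 X).
Local Notation E i j := (delta_mx i j : M).
Local Notation coefs := ('I_n -> 'I_n -> 'I_n -> 'I_n -> C).
Implicit Types s t : coefs.

Let n0 : (n%:R : C) != 0.
Proof. by rewrite pnatr_eq0. Qed.

(** In [t k l i j] the input unit [(k, l)] comes before the output unit [(i, j)]. *)
Definition coef_op t : 'End(M) :=
  linext (fun k l => \sum_i \sum_j t k l i j *: delta_mx i j).

Lemma coef_opE t k l : coef_op t (E k l) = \sum_i \sum_j t k l i j *: E i j.
Proof. exact: linfun_delta_sum. Qed.

Lemma coef_opP t k l i j : (coef_op t (E k l) : 'M_n) i j = t k l i j.
Proof.
have -> : coef_op t (E k l) = \matrix_(i, j) t k l i j.
  rewrite coef_opE [RHS]matrix_sum_delta; apply: eq_bigr => a _; apply: eq_bigr => b _.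
  by rewrite mxE.
by rewrite mxE.
Qed.

Lemma coef_op_eq (T : 'End(M)) t :
  (forall k l i j, (T (E k l) : 'M_n) i j = t k l i j) -> T = coef_op t.
Proof.
by move=> Tt; apply: matrix_lfun_eq => k l; apply/matrixP => i j; rewrite Tt coef_opP.
Qed.

Lemma eq_coef_op s t : (forall k l i j, s k l i j = t k l i j) -> coef_op s = coef_op t.
Proof. by move=> st; apply: coef_op_eq => k l i j; rewrite coef_opP. Qed.

Lemma coef_op_id : \1%VF = coef_op (fun k l i j => ((k == i) && (l == j))%:R).
Proof. by apply: coef_op_eq => k l i j; rewrite id_lfunE mxE [i == k]eq_sym [j == l]eq_sym. Qed.

Lemma mxtrace_delta k l : \tr (delta_mx k l : 'M[C]_n) = (k == l)%:R.
Proof.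
rewrite /mxtrace (bigD1 k) //= mxE eqxx big1 ?addr0 => [|i ik]; first by rewrite /=.
by rewrite mxE (negPf ik).
Qed.

Lemma opJ_delta k l : opJ X (E k l) = (n%:R * (k == l)%:R) *: (1%:M : 'M_n).
Proof.
rewrite (opJE (matrix_ogb n') (matrix_set_algebra n') (matrix_set_involution n')).
by rewrite dsqE /= mxtrace_delta expr2 -mulrA [n%:R * (_ / _)]mulrCA mulfV // mulr1.
Qed.

Definition compl_coef t : coefs := fun k l i j =>
  n%:R * ((k == l) && (i == j))%:R - ((k == i) && (l == j))%:R - t k l i j.

Lemma compl_coef_op t : compl_qg (coef_op t) = coef_op (compl_coef t).
Proof.
apply: coef_op_eq => k l i j; rewrite /compl_qg !add_lfunE !opp_lfunE opJ_delta id_lfunE.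
rewrite !mxE coef_opP /compl_coef [i == k]eq_sym [j == l]eq_sym.
by rewrite -[nat_of_bool (_ && (i == j))]mulnb natrM mulrA.
Qed.

Lemma complete_coef_op :
  complete_qg X = coef_op (fun k l i j =>
    n%:R * ((k == l) && (i == j))%:R - ((k == i) && (l == j))%:R).
Proof.
apply: coef_op_eq => k l i j; rewrite /complete_qg !add_lfunE !opp_lfunE opJ_delta id_lfunE.
by rewrite !mxE [i == k]eq_sym [j == l]eq_sym -[nat_of_bool (_ && (i == j))]mulnb natrM mulrA.
Qed.

Lemma coef_op_adj t : (coef_op t)^† = coef_op (fun k l i j => Num.conj (t i j k l)).
Proof.
apply: (adj_eq (matrix_ogb n') (matrix_ogb n')) => -[k l] [i j] /=.
rewrite ip_delta coef_opP.
have [_ cj _ _ _] := @matrix_ogb R n'.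
by rewrite cj ip_delta coef_opP rmorphM fmorphV /= conjC_nat conjCK.
Qed.

Lemma qm_coef_op s t k m l r i j :
  (qm X (tpure (coef_op s (E k m)) (coef_op t (E l r))) : 'M_n) i j =
  \sum_q s k m i q * t l r q j.
Proof.
rewrite (qmE (matrix_set_algebra n')) /= mxE; apply: eq_bigr => q _.
by rewrite !coef_opP.
Qed.

Lemma schur_coef_op s t :
  schur (coef_op s) (coef_op t) =
  coef_op (fun k l i j => n%:R^-1 * \sum_m \sum_q s k m i q * t m l q j).
Proof.
apply: coef_op_eq => k l i j; rewrite /schur scale_lfunE !comp_lfunE qm_adj mdagE !lfun_sumZ.
rewrite mxE summxE dsqE mulr_sumr mulr_sumr; apply: eq_bigr => m _.
rewrite mxE tmapE qm_coef_op mulrA; congr (_ * _).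
by rewrite expr2 invfM -mulrA mulVf ?mulr1.
Qed.

Lemma opstar_coef_op t :
  opstar (coef_op t) = coef_op (fun a b k i => Num.conj (t b a i k)).
Proof.
apply: coef_op_eq => a b k i; rewrite /opstar !comp_lfunE runitIE tmapE id_lfunE.
rewrite /coev comp_lfunE qiE scale1r qm_adj /=.
have -> : (1%:M : M) = \sum_j 1 *: E j j.
  apply/matrixP => p q; rewrite summxE (bigD1 p) //= big1 => [|j jp].
    by rewrite !mxE eqxx addr0 mul1r eq_sym.
  by rewrite !mxE [p == j]eq_sym (negPf jp) mulr0.
rewrite lfun_sumZ tpure_sumr !lfun_sumZ summxE.
transitivity (\sum_j \sum_m (if (m == k) && (j == i) then Num.conj (t b a i k) else 0)); last first.
  rewrite (bigD1 i) //= (bigD1 k) //= !eqxx !big1 ?addr0 // => [j ji|m mk].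
    by rewrite big1 // => m _; rewrite (negPf ji) andbF.
  by rewrite (negPf mk).
apply: eq_bigr => j _; rewrite scale1r mdagE tpure_sumr !lfun_sumZ summxE.
apply: eq_bigr => m _; rewrite !tmapE !id_lfunE assocIE tmapE id_lfunE lunitE.
rewrite /ev comp_lfunE (qi_adjE (matrix_ogb n') (matrix_set_algebra n') (matrix_set_involution n')).
rewrite !mxE (qmE (matrix_set_algebra n')) coef_op_adj /=.
have -> : \tr (delta_mx a b *m (coef_op (fun k l i j : 'I_n => (t i j k l)^*) (E j m) : 'M_n)) =
    Num.conj (t b a j m).
  rewrite mxtrace_mulC /mxtrace (bigD1 b) //= big1 ?addr0 => [|p pb]; last first.
    by rewrite !mxE big1 // => q _; rewrite !mxE (negPf pb) andbF mulr0.
  rewrite !mxE (bigD1 a) //= !mxE !eqxx mulr1 coef_opP big1 ?addr0 // => q qa.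
  by rewrite !mxE (negPf qa) mulr0.
rewrite [k == m]eq_sym [i == j]eq_sym; case: eqP => [->|]; case: eqP => [->|]; rewrite ?mulr0 //=.
by rewrite mulr1 mulrCA mulfV // mulr1.
Qed.

Let oM := @matrix_ogb R n'.
Let oMM := ogb_tens oM oM.

Lemma tens_delta_eq (x y : tens M M) :
  (forall p r u v, ip (tpure (E p r) (E u v) : tens M M) x =
                   ip (tpure (E p r) (E u v) : tens M M) y) -> x = y.
Proof. by move=> xy; apply: (ogb_eq oMM) => -[[p r] [u v]]; apply: xy. Qed.

Lemma ip_filled_tri t i j p r u v :
  ip (tpure (E p r) (E u v) : tens M M) (filled_tri (coef_op t) (E i j)) =
  n%:R^-1 * \sum_a \sum_b \sum_m t i j a b * t a m p r * t m b u v.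
Proof.
rewrite /filled_tri !comp_lfunE coef_opE qm_adj mulr_sumr.
rewrite sum_scale1 !lfun_sumZ (ogb_ip_sumr oMM); apply: eq_bigr => a _.
rewrite mul1r !lfun_sumZ (ogb_ip_sumr oMM) mulr_sumr; apply: eq_bigr => b _.
rewrite mdagE !lfun_sumZ (ogb_ip_sumr oMM) !mulr_sumr; apply: eq_bigr => m _.
rewrite tmapE (ip_tens _ _ _ _ oM oM) !ip_delta !coef_opP.
by move: n0; move: (n%:R : C) => N N0; field.
Qed.

(** The two comultiplications contribute [n^2], which the two inner products cancel; [filled_tri]
    has a single comultiplication, whence the [1/n] in [ip_filled_tri]. *)
Lemma ip_tri s t w i j p r u v :
  ip (tpure (E p r) (E u v) : tens M M) (tri (coef_op s) (coef_op t) (coef_op w) (E i j)) =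
  \sum_k \sum_q \sum_z s i k p q * t r q u z * w k j z v.
Proof.
rewrite /tri !comp_lfunE qm_adj mdagE !lfun_sumZ (ogb_ip_sumr oMM).
apply: eq_bigr => k _; rewrite tmapE tmapE id_lfunE (coef_opE s) sum_scale1 lfun_sumZ tpure_suml.
(* Orthogonality to [E p r] on the first leg leaves only row [p] of the left edge and, further on,
   only the splitting of the second comultiplication at [r]. *)
rewrite !lfun_sumZ (ogb_ip_sumr oMM) (bigD1 p) //=.
rewrite [X in _ * (_ + X)]big1 ?addr0 => [|a ap]; last first.
  rewrite mul1r !lfun_sumZ !tpure_suml !lfun_sumZ (ogb_ip_sumr oMM) big1 // => b _.
  rewrite mdagE tpure_suml !lfun_sumZ (ogb_ip_sumr oMM) big1 ?mulr0 // => c _.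
  rewrite assocE !tmapE (ip_tens _ _ _ _ oM oM) ip_delta !id_lfunE mxE [p == a]eq_sym (negPf ap).
  by rewrite !mul0r mulr0.
rewrite mul1r lfun_sumZ tpure_suml !lfun_sumZ (ogb_ip_sumr oMM) mulr_sumr.
apply: eq_bigr => q _; rewrite mdagE tpure_suml !lfun_sumZ (ogb_ip_sumr oMM).
rewrite (bigD1 r) //= [X in _ * (_ + X)]big1 ?addr0 => [|c cr]; last first.
  rewrite assocE !tmapE (ip_tens _ _ _ _ oM oM) ip_delta !id_lfunE mxE [r == c]eq_sym (negPf cr).
  by rewrite andbF !mul0r mulr0.
rewrite assocE !tmapE (ip_tens _ _ _ _ oM oM) !ip_delta !id_lfunE mxE !eqxx /=.
rewrite qm_coef_op mulr_suml !mulr_sumr; apply: eq_bigr => z _.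
by move: n0; move: (n%:R : C) => N N0; field.
Qed.

End MatrixOperators.

(** * Integer coefficient tables *)

(** The shape of the right-hand side of [three_point_regular], with one value for each of its
    fifteen diagrams. *)
Lemma ip_lfun_combination (R : realType) (H K : hilb R) (x : K) (y : H)
    (c1 c2 c3 c4 c5 c6 c7 : R[i]) (d1 d2 d3 d4 d5 d6 d7 d8 d9 d10 d11 d12 d13 d14 d15 : R[i])
    (f1 f2 f3 f4 f5 f6 f7 f8 f9 g1 g2 g3 g4 g5 g6 : 'Hom(H, K)) : is_hilbert K ->
  ip x (f1 y) = d1 -> ip x (f2 y) = d2 -> ip x (f3 y) = d3 -> ip x (f4 y) = d4 ->
  ip x (f5 y) = d5 -> ip x (f6 y) = d6 -> ip x (f7 y) = d7 -> ip x (f8 y) = d8 ->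
  ip x (f9 y) = d9 -> ip x (g1 y) = d10 -> ip x (g2 y) = d11 -> ip x (g3 y) = d12 ->
  ip x (g4 y) = d13 -> ip x (g5 y) = d14 -> ip x (g6 y) = d15 ->
  ip x ((c1 *: f1 + c2 *: (f2 + f3 + f4) + c3 *: (f5 + f6 + f7) + c4 *: f8
    + c5 *: (f9 + g1 + g2) + c6 *: (g3 + g4 + g5) + c7 *: g6) y) =
  c1 * d1 + c2 * (d2 + d3 + d4) + c3 * (d5 + d6 + d7) + c4 * d8
    + c5 * (d9 + d10 + d11) + c6 * (d12 + d13 + d14) + c7 * d15.
Proof.
move=> hK; do 15!move=> <-.
by rewrite !add_lfunE !scale_lfunE !add_lfunE !ipDr // !ipZr // !ipDr.
Qed.

Section IntegerTables.
Context {R : realType}.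
Local Notation C := R[i].

(** Tables live in binary integers, where [vm_compute] decides identities; this ring morphism
    carries the results to [C]. *)
Definition Zcast (z : Z) : C := (int_of_Z z)%:~R.

Lemma ZcastD x y : Zcast (Z.add x y) = Zcast x + Zcast y.
Proof. by rewrite /Zcast -[Z.add x y]/(x + y) !rmorphD. Qed.

Lemma ZcastN x : Zcast (Z.opp x) = - Zcast x.
Proof. by rewrite /Zcast -[Z.opp x]/(- x) !rmorphN. Qed.

Lemma ZcastM x y : Zcast (Z.mul x y) = Zcast x * Zcast y.
Proof. by rewrite /Zcast -[Z.mul x y]/(x * y) !rmorphM. Qed.

Lemma Zcast_nat m : Zcast (Z.of_nat m) = m%:R.
Proof. by rewrite /Zcast (_ : int_of_Z _ = m%:Z) //; lia. Qed.

Lemma Zcast_inj x y : Zcast x = Zcast y -> x = y.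
Proof.
by rewrite /Zcast => /(mulrIz (@oner_neq0 _)) /(congr1 Z_of_int); rewrite !int_of_ZK.
Qed.

Definition zsum n (f : nat -> Z) : Z := foldr (fun i a => Z.add (f i) a) Z0 (iota 0 n).

Lemma Zcast_sum n f : Zcast (zsum n f) = \sum_(i < n) Zcast (f i).
Proof.
rewrite -(big_mkord xpredT (fun i => Zcast (f i))) /index_iota subn0 /zsum.
by elim: iota => [|i s IH]; rewrite ?big_nil ?big_cons //= ZcastD IH.
Qed.

Definition zall n (P : nat -> bool) : bool := all P (iota 0 n).

Lemma zallP n P : zall n P -> forall i : 'I_n, P i.
Proof. by move/allP => nP i; apply: nP; rewrite mem_iota ltn_ord. Qed.

Variable n' : nat.
Local Notation n := n'.+1.
Local Notation X := (matrix_set R n).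
Local Notation M := (l2 X).
Local Notation E i j := (delta_mx i j : M).
Local Notation table := (nat -> nat -> nat -> nat -> Z).
Implicit Types z w : table.

Let n0 : (n%:R : C) != 0.
Proof. by rewrite pnatr_eq0. Qed.

Let zn := Z.of_nat n.
Let zd (b : bool) := if b then 1%ZZ else 0%ZZ.

(* Entries of the tables are doubled, so that those of [qG4] become integral. *)
Definition zop z : 'End(M) := coef_op (fun k l i j : 'I_n => Zcast (z k l i j) / 2).

Definition zid : table := fun k l i j => Z.mul 2 (zd ((k == i) && (l == j))).

Definition zcomplete : table := fun k l i j =>
  Z.add (Z.mul (Z.mul 2 zn) (zd ((k == l) && (i == j)))) (Z.opp (zid k l i j)).

Definition zcompl z : table := fun k l i j =>
  Z.add (zcomplete k l i j) (Z.opp (z k l i j)).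

Lemma Zcast_zd b : Zcast (zd b) = b%:R.
Proof. by case: b. Qed.

Lemma zop_id : \1%VF = zop zid.
Proof.
rewrite coef_op_id; apply: eq_coef_op => k l i j; rewrite ZcastM Zcast_zd -!val_eqE /=.
by rewrite mulrAC divff ?mul1r // pnatr_eq0.
Qed.

Lemma Zcast_zcomplete k l i j : Zcast (zcomplete k l i j) / 2 =
  n%:R * ((k == l) && (i == j))%:R - ((k == i) && (l == j))%:R.
Proof. by rewrite ZcastD ZcastN !ZcastM !Zcast_zd Zcast_nat (_ : Zcast 2 = 2) //; field. Qed.

Lemma zop_complete : complete_qg X = zop zcomplete.
Proof. by rewrite complete_coef_op; apply: eq_coef_op => k l i j; rewrite Zcast_zcomplete. Qed.

Lemma zop_compl z : compl_qg (zop z) = zop (zcompl z).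
Proof.
rewrite compl_coef_op; apply: eq_coef_op => k l i j.
by rewrite ZcastD mulrDl Zcast_zcomplete ZcastN mulNr.
Qed.

Definition zall4 (P : nat -> nat -> nat -> nat -> bool) :=
  zall n (fun k => zall n (fun l => zall n (fun i => zall n (fun j => P k l i j)))).

Lemma zall4P P : zall4 P -> forall k l i j : 'I_n, P k l i j.
Proof. by move=> H k l i j; have := zallP (zallP (zallP (zallP H k) l) i) j. Qed.

Lemma zop_neq z w : ~~ zall4 (fun k l i j => Z.eqb (z k l i j) (w k l i j)) ->
  zop z != zop w.
Proof.
apply: contraNneq => zw.
have ord m : m \in iota 0 n -> exists i : 'I_n, m = i.
  by rewrite mem_iota => mn; exists (Ordinal mn).
apply/allP => k /ord[{}k ->]; apply/allP => l /ord[{}l ->].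
apply/allP => i /ord[{}i ->]; apply/allP => j /ord[{}j ->].
have := congr1 (fun T : 'End(M) => (T (E k l) : 'M_n) i j) zw.
rewrite !coef_opP => /(divIf _) /Zcast_inj -> //; first exact: Z.eqb_refl.
by rewrite pnatr_eq0.
Qed.

Definition zschur z w : table := fun k l i j =>
  zsum n (fun m => zsum n (fun q => Z.mul (z k m i q) (w m l q j))).

Lemma schur_zop z w :
  schur (zop z) (zop w) = coef_op (fun k l i j : 'I_n => Zcast (zschur z w k l i j) / (4 * n%:R)).
Proof.
rewrite schur_coef_op; apply: eq_coef_op => k l i j.
rewrite Zcast_sum mulr_sumr mulr_suml; apply: eq_bigr => m _.
rewrite Zcast_sum mulr_sumr mulr_suml; apply: eq_bigr => q _.
by rewrite ZcastM; move: n0; move: (n%:R : C) => N N0; field.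
Qed.

(** The Schur square has entries [zschur z z / (4 n)] while the operator has [z / 2], hence the
    factor [2 n]. *)
Lemma zop_quantum_graph z :
  zall4 (fun k l i j => Z.eqb (zschur z z k l i j) (Z.mul (Z.mul 2 zn) (z k l i j))) ->
  quantum_graph (zop z).
Proof.
move=> /zall4P zz; split; first exact: matrix_finite_quantum_set.
rewrite schur_zop; apply: eq_coef_op => k l i j; have /Z.eqb_eq -> := zz k l i j.
rewrite !ZcastM Zcast_nat (_ : Zcast 2 = 2) //.
by move: n0; move: (n%:R : C) => N N0; field.
Qed.

Lemma zop_irreflexive z :
  zall4 (fun k l i j => Z.eqb (zschur z zid k l i j) 0 && Z.eqb (zschur zid z k l i j) 0) ->
  irreflexive_qg (zop z).
Proof.
move=> /zall4P zz; have op0 : coef_op (fun _ _ _ _ : 'I_n => 0 : C) = 0.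
  by symmetry; apply: coef_op_eq => k l i j; rewrite zero_lfunE mxE.
split; rewrite zop_id schur_zop -op0; apply: eq_coef_op => k l i j;
  have /andP[/Z.eqb_eq z1 /Z.eqb_eq z2] := zz k l i j; by rewrite ?z1 ?z2 mul0r.
Qed.

Lemma conj_Zcast x : Num.conj (Zcast x / 2) = Zcast x / 2.
Proof. by rewrite rmorphM fmorphV /= conjC_nat /Zcast rmorph_int. Qed.

Lemma zop_undirected z :
  zall4 (fun k l i j => Z.eqb (z i j k l) (z k l i j)) -> undirected_qg (zop z).
Proof.
move=> /zall4P zz; rewrite /undirected_qg coef_op_adj; apply: eq_coef_op => k l i j.
by have /Z.eqb_eq -> := zz k l i j; rewrite conj_Zcast.
Qed.

Lemma zop_real z :
  zall4 (fun k l i j => Z.eqb (z l k j i) (z k l i j)) -> real_qg (zop z).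
Proof.
move=> /zall4P zz; rewrite /real_qg opstar_coef_op; apply: eq_coef_op => k l i j.
by have /Z.eqb_eq -> := zz k l i j; rewrite conj_Zcast.
Qed.

Definition zfill (z : table) (i j p r u v : nat) :=
  zsum n (fun a => zsum n (fun b => zsum n (fun m =>
    Z.mul (Z.mul (z i j a b) (z a m p r)) (z m b u v)))).

Definition ztri (s t w : table) (i j p r u v : nat) :=
  zsum n (fun k => zsum n (fun q => zsum n (fun y =>
    Z.mul (Z.mul (s i k p q) (t r q u y)) (w k j y v)))).

(** The integer parameters are eight times the actual ones, which makes those of [qG4] integral.
    Each diagram has three doubled edges, so its table is eight times too large as well. Clearing
    [64] leaves [8 n] on the left, with [n] from [dsq X / n]. *)
Definition zthree_point z (k la mu q3 q2 q1 q0 : Z) (i j p r u v : nat) :=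
  let c := zcompl z in
  let tr a b d := ztri a b d i j p r u v in
  Z.eqb (Z.mul (Z.mul 8 zn) (zfill z i j p r u v))
    (Z.add (Z.add (Z.add (Z.add (Z.add (Z.add
     (Z.mul q3 (tr z z z))
     (Z.mul q2 (Z.add (Z.add (tr c z z) (tr z c z)) (tr z z c))))
     (Z.mul q1 (Z.add (Z.add (tr c c z) (tr c z c)) (tr z c c))))
     (Z.mul q0 (tr c c c)))
     (Z.mul la (Z.add (Z.add (tr z z zid) (tr z zid z)) (tr zid z z))))
     (Z.mul mu (Z.add (Z.add (tr c c zid) (tr c zid c)) (tr zid c c))))
     (Z.mul k (tr zid zid zid))).

Lemma ip_ztri (s t w : table) (i j p r u v : 'I_n) :
  ip (tpure (E p r) (E u v) : tens M M) (tri (zop s) (zop t) (zop w) (E i j)) =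
  Zcast (ztri s t w i j p r u v) / 8.
Proof.
rewrite ip_tri Zcast_sum mulr_suml; apply: eq_bigr => k _.
rewrite Zcast_sum mulr_suml; apply: eq_bigr => q _.
by rewrite Zcast_sum mulr_suml; apply: eq_bigr => y _; rewrite !ZcastM; field.
Qed.

Lemma zop_three_point z (k la mu q3 q2 q1 q0 : Z) :
  zall4 (fun i j p r => zall n (fun u => zall n (fun v =>
    zthree_point z k la mu q3 q2 q1 q0 i j p r u v))) ->
  three_point_regular (zop z) (Zcast k / 8) (Zcast la / 8) (Zcast mu / 8)
    (Zcast q3 / 8) (Zcast q2 / 8) (Zcast q1 / 8) (Zcast q0 / 8).
Proof.
move=> /zall4P zz; rewrite /three_point_regular /= zop_compl zop_id.
apply: matrix_lfun_eq => i j; apply: tens_delta_eq => p r u v.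
have hMM := ogb_hilbert (ogb_tens (@matrix_ogb R n') (@matrix_ogb R n')).
pose tE a b d := ip_ztri a b d i j p r u v; pose c := zcompl z.
rewrite scale_lfunE (ipZr hMM) ip_filled_tri.
rewrite (ip_lfun_combination _ _ _ _ _ _ _ hMM
  (tE z z z) (tE c z z) (tE z c z) (tE z z c) (tE c c z)
  (tE c z c) (tE z c c) (tE c c c) (tE z z zid) (tE z zid z)
  (tE zid z z) (tE c c zid) (tE c zid c) (tE zid c c) (tE zid zid zid)).
rewrite dsqE.
rewrite (_ : \sum_a \sum_b \sum_m _ = Zcast (zfill z i j p r u v) / 8); last first.
  rewrite Zcast_sum mulr_suml; apply: eq_bigr => a _.
  rewrite Zcast_sum mulr_suml; apply: eq_bigr => b _.
  by rewrite Zcast_sum mulr_suml; apply: eq_bigr => y _; rewrite !ZcastM; field.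
have /zallP/(_ u)/zallP/(_ v)/Z.eqb_eq := zz i j p r; rewrite -/c.
move: (zfill z i j p r u v) => F.
do 15?[match goal with |- context [ztri ?a ?b ?d i j p r u v] =>
  move: (ztri a b d i j p r u v) => ? end].
move=> /(congr1 Zcast); rewrite !(ZcastD, ZcastM) Zcast_nat (_ : Zcast 8 = 8) // => H.
have -> : n%:R ^+ 2 * (n%:R^-1 * (Zcast F / 8)) = 8 * n%:R * Zcast F / 64.
  by move: n0; move: (n%:R : C) => N N0; field.
by rewrite H; field.
Qed.

End IntegerTables.

(** * The quantum graphs over M_2 and M_3 *)

Arguments zop {R n'} z.

Section Examples.
Context {R : realType}.
Local Notation C := R[i].

Lemma Zcast0 : Zcast Z0 = 0 :> C. Proof. by []. Qed.

Lemma Zcast_pos p : Zcast (Z.pos p) = (Pos.to_nat p)%:R :> C.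
Proof. by rewrite -Zcast_nat positive_nat_Z. Qed.

Lemma Zcast_neg p : Zcast (Z.neg p) = - (Pos.to_nat p)%:R :> C.
Proof. by rewrite -[Z.neg p]/(Z.opp (Z.pos p)) ZcastN Zcast_pos. Qed.

Definition ZcastE := (Zcast0, Zcast_pos, Zcast_neg).

Lemma linextE n' (F : 'I_n'.+1 -> 'I_n'.+1 -> 'M[C]_n'.+1) k l :
  linext F (delta_mx k l : l2 (matrix_set R n'.+1)) = F k l.
Proof. exact: linfun_delta_sum. Qed.

(** On the indices 0 and 1 the condition [i + k = 1] is the exchange [i = 1 - k]. *)
Definition zA3 (k l i j : nat) : Z :=
  if [&& k == l, i == j & (i + k)%N == 1%N] then 4%ZZ else 0%ZZ.

Definition zG3 (k l i j : nat) : Z :=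
  if (k == i) && (l == j) then (if k == l then 4%ZZ else (-2)%ZZ) else 0%ZZ.

Definition zG4 (k l i j : nat) : Z :=
  if (if k == l then (i == j) && (i != k) else (i == l) && (j == k)) then 3%ZZ else 0%ZZ.

(** The condition [i - j = k - l] modulo 3 is written with sums, since subtraction of naturals
    truncates. *)
Definition z9P (k l i j : nat) : Z :=
  Z.add (Z.add (if ((i + l) %% 3 == (k + j) %% 3)%N then 2%ZZ else 0%ZZ)
               (if [&& i == j, j == k & k == l] then 6%ZZ else 0%ZZ))
        (if (i == k) && (j == l) then (-4)%ZZ else 0%ZZ).

Lemma qA3_zop : qA3 R = zop zA3.
Proof.
apply: coef_op_eq => k l i j; rewrite /qA3 linextE.
have -> : (if k == l then 2%:R *: delta_mx (rev_ord k) (rev_ord k) else 0 : 'M[C]_2) i j =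
    if [&& k == l, i == rev_ord k & j == rev_ord k] then 2%:R else 0.
  by case: eqP => _; rewrite !mxE //; case: (_ && _); rewrite ?mulr1 ?mulr0.
have -> : [&& k == l, i == rev_ord k & j == rev_ord k] =
    [&& k == l :> nat, i == j :> nat & (i + k)%N == 1%N].
  by case: k => [[|[|//]] k2]; case: l => [[|[|//]] l2];
    case: i => [[|[|//]] i2]; case: j => [[|[|//]] j2].
by rewrite /zA3; case: ifP => _; rewrite ZcastE /Pos.to_nat /= ?mul0r //; field.
Qed.

Lemma qA4_zop : qA4 R = zop (zcomplete 1).
Proof. exact: zop_complete. Qed.

Lemma qK9_zop : qK9 R = zop (zcomplete 2).
Proof. exact: zop_complete. Qed.

Lemma qG3_zop : qG3 R = zop zG3.
Proof.
apply: coef_op_eq => k l i j; rewrite /qG3 linextE /zG3.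
have E : (i == k) && (j == l) = (k == i :> nat) && (l == j :> nat).
  by rewrite -!val_eqE [val i == _]eq_sym [val j == _]eq_sym.
rewrite -[val k == val l]/(k == l) -E; case: eqP => [<-|_]; rewrite !mxE;
  case: (_ && _); by rewrite ZcastE /Pos.to_nat /= ?mul0r ?mulr0 ?oppr0 //; field.
Qed.

Lemma qG4_zop : qG4 R = zop zG4.
Proof.
apply: coef_op_eq => k l i j; rewrite /qG4 linextE /zG4 -[k == l]val_eqE /=.
case: ifP => kl; rewrite !mxE.
  rewrite summxE.
  have -> : \sum_(m < 3 | m != k) (delta_mx m m : 'M[C]_3) i j = ((i == j) && (i != k))%:R.
    have [ik|ik] := eqVneq i k; rewrite ?andbF ?andbT.
      by rewrite big1 // => m mk; rewrite mxE ik eq_sym (negPf mk).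
    rewrite (bigD1 i) //= mxE eqxx eq_sym big1 ?addr0 // => m /andP[_ mi].
    by rewrite mxE eq_sym (negPf mi).
  by rewrite -!val_eqE; case: ifP => _ /=; rewrite ZcastE /Pos.to_nat /= ?mul0r ?mulr0 //; field.
by rewrite -!val_eqE; case: ifP => _ /=; rewrite ZcastE /Pos.to_nat /= ?mul0r ?mulr0 //; field.
Qed.

Lemma q9P_zop : q9P R = zop z9P.
Proof.
apply: eq_coef_op => k l i j; rewrite /z9P !ZcastD.
have -> : (i - j == k - l) = (((i + l) %% 3 == (k + j) %% 3)%N).
  by case: k => [[|[|[|//]]] k2]; case: l => [[|[|[|//]]] l2];
    case: i => [[|[|[|//]]] i2]; case: j => [[|[|[|//]]] j2].
rewrite -[[&& i == j, j == k & k == l]]/[&& val i == j, val j == k & val k == l].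
rewrite -[(i == k) && (j == l)]/((val i == k) && (val j == l)).
by case: (_ == _ %% 3)%N; case: [&& _, _ & _]; case: (_ && _); rewrite ZcastE /Pos.to_nat /=; field.
Qed.

Lemma matrix_lfun_expand n' (V : vectType C) (f : 'Hom(l2 (matrix_set R n'.+1), V))
    (a : 'M[C]_n'.+1) :
  f a = \sum_i \sum_j a i j *: f (delta_mx i j : l2 (matrix_set R n'.+1)).
Proof.
rewrite {1}(matrix_sum_delta a) linear_sum; apply: eq_bigr => i _ /=.
by rewrite lfun_sumZ.
Qed.

(** In the degree term the counit leaves the normalized trace of the image of [E i m]; the [n] of
    the comultiplication turns it into the plain trace. *)
Lemma zop_laplacian z (a : 'M[C]_2) (m j : 'I_2) :
  (laplacian (zop z : 'End(l2 (matrix_set R 2))) a : 'M_2) m j =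
  \sum_i a i j * (\sum_(p < 2) Zcast (z i m p p) / 2) -
  \sum_k \sum_l a k l * (Zcast (z k l m j) / 2).
Proof.
rewrite /laplacian add_lfunE opp_lfunE mxE [X in _ + X]mxE; congr (_ - _); last first.
  rewrite matrix_lfun_expand summxE; apply: eq_bigr => k _.
  by rewrite summxE; apply: eq_bigr => l _; rewrite mxE coef_opP.
rewrite matrix_lfun_expand summxE; apply: eq_bigr => k _.
rewrite summxE (bigD1 j) //= [X in _ + X]big1 ?addr0 => [|l lj].
  rewrite mxE !comp_lfunE qm_adj mdagE !lfun_sumZ summxE; congr (_ * _).
  rewrite (bigD1 m) //= big1 ?addr0 => [|q qm]; rewrite !tmapE !id_lfunE lunitE !mxE.
    rewrite !eqxx mulr1 /=.
    rewrite (qi_adjE (matrix_ogb 1) (matrix_set_algebra 1) (matrix_set_involution 1)) /=.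
    rewrite mulrC divfK ?pnatr_eq0 //; apply: eq_bigr => p _; exact: coef_opP.
  by rewrite [m == q]eq_sym (negPf qm) !mulr0.
rewrite mxE !comp_lfunE qm_adj mdagE !lfun_sumZ summxE big1 ?mulr0 // => q _.
by rewrite !tmapE !id_lfunE lunitE !mxE [j == l]eq_sym (negPf lj) andbF !mulr0.
Qed.

Lemma connected_scalar_kernel (T : 'End(l2 (matrix_set R 2))) :
  (forall a : 'M[C]_2, laplacian T a = 0 <-> a = (a 0 0)%:M) -> connected_qg T.
Proof.
move=> kerT; rewrite /connected_qg.
have -> : lker (laplacian T) = <[(1%:M : 'M[C]_2) : l2 (matrix_set R 2)]>%VS.
  apply/vspaceP => a; rewrite memv_ker; apply/eqP/vlineP => [/kerT ->|[k ->]].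
    by exists ((a : 'M_2) 0 0); rewrite scale_scalar_mx mulr1.
  by apply/kerT; rewrite scale_scalar_mx mulr1 mxE eqxx.
rewrite dim_vline; apply/eqP; rewrite eqb1; apply/eqP => /matrixP/(_ 0 0).
by rewrite !mxE eqxx => /eqP; rewrite oner_eq0.
Qed.

Lemma mx2_eqP (a b : 'M[C]_2) :
  a = b <-> [/\ a 0 0 = b 0 0, a 0 1 = b 0 1, a 1 0 = b 1 0 & a 1 1 = b 1 1].
Proof.
have I2 (i : 'I_2) : i = 0 \/ i = 1.
  by case: i => [[|[|//]] i2]; [left|right]; apply: val_inj.
split=> [->//|[ab1 ab2 ab3 ab4]]; apply/matrixP => i j.
by case: (I2 i) => ->; case: (I2 j) => ->.
Qed.

Let ord1E : lift ord0 ord0 = 1 :> 'I_2.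
Proof. exact: val_inj. Qed.

Lemma qA3_connected : connected_qg (qA3 R).
Proof.
rewrite qA3_zop; apply: connected_scalar_kernel => a.
rewrite !mx2_eqP !zop_laplacian !big_ord_recl !big_ord0 !ord1E !mxE /=.
rewrite /zA3 /= !ZcastE /Pos.to_nat /= -!/(0 : 'I_2).
move: (a 0 0) (a 0 1) (a 1 0) (a 1 1) => x y v w.
split=> [[e1 e2 e3 e4]|[_ -> -> ->]]; last by split; field.
split=> //.
(* The equations are [2 y = 0], [2 v = 0] off the diagonal and [2 (x - w) = 0] on it. *)
- by rewrite -[RHS](mul0r 2^-1) -e2; field.
- by rewrite -[RHS](mul0r 2^-1) -e3; field.
- by rewrite -[RHS]subr0 -(mul0r 2^-1) -e1; field.
Qed.

Lemma qA4_connected : connected_qg (qA4 R).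
Proof.
rewrite qA4_zop; apply: connected_scalar_kernel => a.
rewrite !mx2_eqP !zop_laplacian !big_ord_recl !big_ord0 !ord1E !mxE /=.
rewrite /zcomplete /zid /= !ZcastE /Pos.to_nat /= -!/(0 : 'I_2).
move: (a 0 0) (a 0 1) (a 1 0) (a 1 1) => x y v w.
split=> [[e1 e2 e3 e4]|[_ -> -> ->]]; last by split; field.
split=> //.
(* Here the degree is 3 and off-diagonal units have eigenvalue -1, so the off-diagonal equations are
   [4 y = 0] and [4 v = 0]. *)
- by rewrite -[RHS](mul0r 4^-1) -e2; field.
- by rewrite -[RHS](mul0r 4^-1) -e3; field.
- by rewrite -[RHS]subr0 -(mul0r 2^-1) -e1; field.
Qed.

Lemma three_point_decide n' z (T : 'End(l2 (matrix_set R n'.+1)))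
    (k la mu q3 q2 q1 q0 : C) (k' la' mu' q3' q2' q1' q0' : Z) :
  T = zop z ->
  zall4 n' (fun i j p r => zall n'.+1 (fun u => zall n'.+1 (fun v =>
    zthree_point n' z k' la' mu' q3' q2' q1' q0' i j p r u v))) ->
  [/\ k = Zcast k' / 8, la = Zcast la' / 8, mu = Zcast mu' / 8 &
     [/\ q3 = Zcast q3' / 8, q2 = Zcast q2' / 8, q1 = Zcast q1' / 8 & q0 = Zcast q0' / 8]] ->
  three_point_regular T k la mu q3 q2 q1 q0.
Proof. by move=> -> /zop_three_point H [-> -> -> [-> -> -> ->]]. Qed.

Lemma qA3_three_point : three_point_regular (qA3 R) 2 0 2 0 0 0 0.
Proof.
apply: (@three_point_decide _ _ _ _ _ _ _ _ _ _ 16 0 16 0 0 0 0 qA3_zop).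
  by vm_compute.
by split; last split; rewrite ZcastE /Pos.to_nat /= ?mul0r //; field.
Qed.

Lemma qA4_three_point : three_point_regular (qA4 R) 3 2 0 1 0 0 0.
Proof.
apply: (@three_point_decide _ _ _ _ _ _ _ _ _ _ 24 16 0 8 0 0 0 qA4_zop).
  by vm_compute.
by split; last split; rewrite ZcastE /Pos.to_nat /= ?mul0r //; field.
Qed.

Lemma qG3_three_point : three_point_regular (qG3 R) 2 1 0 0 0 0 0.
Proof.
apply: (@three_point_decide _ _ _ _ _ _ _ _ _ _ 16 8 0 0 0 0 0 qG3_zop).
  by vm_compute.
by split; last split; rewrite ZcastE /Pos.to_nat /= ?mul0r //; field.
Qed.

Lemma qG4_three_point : three_point_regular (qG4 R) 3 (3 / 4) (3 / 4)
  (3 / 8) (- (3 / 8)) (3 / 8) (- (3 / 8)).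
Proof.
apply: (@three_point_decide _ _ _ _ _ _ _ _ _ _ 24 6 6 3 (-3) 3 (-3) qG4_zop).
  by vm_compute.
by split; last split; rewrite ZcastE /Pos.to_nat /= ?mul0r //; field.
Qed.

Lemma q9P_three_point : three_point_regular (q9P R) 4 1 2 0 0 1 0.
Proof.
apply: (@three_point_decide _ _ _ _ _ _ _ _ _ _ 32 8 16 0 0 8 0 q9P_zop).
  by vm_compute.
by split; last split; rewrite ZcastE /Pos.to_nat /= ?mul0r //; field.
Qed.

Lemma qK9_three_point : three_point_regular (qK9 R) 8 7 0 6 0 0 0.
Proof.
apply: (@three_point_decide _ _ _ _ _ _ _ _ _ _ 64 56 0 48 0 0 0 qK9_zop).
  by vm_compute.
by split; last split; rewrite ZcastE /Pos.to_nat /= ?mul0r //; field.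
Qed.

Lemma qA4_graph : quantum_graph (qA4 R) /\ irreflexive_qg (qA4 R).
Proof.
by rewrite qA4_zop; split; [apply: zop_quantum_graph|apply: zop_irreflexive]; vm_compute.
Qed.

Lemma qA3_graph : quantum_graph (qA3 R) /\ irreflexive_qg (qA3 R).
Proof.
by rewrite qA3_zop; split; [apply: zop_quantum_graph|apply: zop_irreflexive]; vm_compute.
Qed.

Lemma M3_graphs (T : 'End(l2 (matrix_set R 3))) :
  T \in [:: qG3 R; qG4 R; q9P R; qK9 R] ->
  [/\ quantum_graph T, irreflexive_qg T, real_qg T & undirected_qg T].
Proof.
rewrite !inE qG3_zop qG4_zop q9P_zop qK9_zop.
by case/or4P => /eqP ->; (split; [apply: zop_quantum_graph|apply: zop_irreflexive
  |apply: zop_real|apply: zop_undirected]); vm_compute.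
Qed.

(** Complementation is an involution, so being complementary is symmetric and one order of each pair
    suffices. *)
Lemma M3_distinct :
  pairwise (fun S T : 'End(l2 (matrix_set R 3)) => (S != T) && (S != compl_qg T))
    [:: qG3 R; qG4 R; q9P R; qK9 R].
Proof.
rewrite /= qG3_zop qG4_zop q9P_zop qK9_zop !zop_compl.
by do ?[apply/andP; split]; first [apply: zop_neq; vm_compute | exact: isT].
Qed.

End Examples.

(** * Classical sets and their twists *)

Section ClassicalSet.
Context {R : realType} (V : finType).
Hypothesis V0 : (0 < #|V|)%N.
Local Notation C := R[i].
Local Notation A := {ffun V -> C^o}.
Local Notation X := (classical_set R V).

Definition dirac (v : V) : A := [ffun w => (w == v)%:R].

Let N0 : (#|V|%:R : C) != 0.
Proof. by rewrite pnatr_eq0 -lt0n. Qed.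

Lemma ffun_expand (a : A) : a = \sum_v (a v : C) *: dirac v.
Proof.
apply/ffunP => w; rewrite sum_ffunE (bigD1 w) //= big1 ?addr0.
  by rewrite !ffunE eqxx [RHS]mulr1.
by move=> v vw; rewrite !ffunE eq_sym (negPf vw) [LHS]mulr0.
Qed.

Lemma spans_dirac : spans dirac.
Proof. by move=> a; exists (fun v => a v); apply: ffun_expand. Qed.

Lemma ip_classical (a b : l2 X) :
  ip a b = (\sum_v Num.conj ((a : A) v : C) * (b : A) v) / #|V|%:R.
Proof.
by rewrite /ip /=; congr (_ / _); apply: eq_bigr => v _; rewrite !ffunE.
Qed.

Lemma classical_algebra : unital_algebra (@qmul R X) (qone X).
Proof.
split=> /= [a k b d|b k a d|a b d|a|a]; apply/ffunP=> v; rewrite !ffunE /=.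
- by rewrite mulrDr; congr (_ + _); apply: mulrCA.
- by rewrite mulrDl; congr (_ + _); rewrite -mulrA.
- exact: mulrA.
- exact: mul1r.
- exact: mulr1.
Qed.

Lemma classical_involution : involution (@qmul R X) (@qstar R X).
Proof.
split=> /= [k a b|a b|a]; apply/ffunP=> v; rewrite !ffunE ?conjCK //.
- by rewrite rmorphD; congr (_ + _); apply: rmorphM.
- by rewrite rmorphM mulrC.
Qed.

Lemma ip_dirac v (a : l2 X) : ip (dirac v : l2 X) a = (a : A) v / #|V|%:R.
Proof.
rewrite ip_classical (bigD1 v) //= ffunE eqxx conjC1 mul1r big1 ?addr0 // => w wv.
by rewrite ffunE (negPf wv) rmorph0 mul0r.
Qed.

Lemma classical_ogb : @ogb R (l2 X) V dirac #|V|%:R^-1.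
Proof.
split=> [u a v w|u v||v w|]; last exact: spans_dirac.
- rewrite !ip_classical mulrA -mulrDl; congr (_ / _); rewrite mulr_sumr -big_split.
  by apply: eq_bigr => i _ /=; rewrite !ffunE mulrDr; congr (_ + _); apply: mulrCA.
- rewrite !ip_classical rmorphM fmorphV /= conjC_nat; congr (_ / _).
  by rewrite rmorph_sum; apply: eq_bigr => i _; rewrite rmorphM /= conjCK mulrC.
- by rewrite invr_gt0 ltr0n.
- by rewrite ip_dirac ffunE mulr_natl.
Qed.

Definition classical_mdag : 'Hom(l2 X, tens (l2 X) (l2 X)) :=
  linfun (fun a : A => \sum_v (a v : C) *:
    (#|V|%:R *: tpure (dirac v : l2 X) (dirac v : l2 X)) : tens (l2 X) (l2 X)).

Lemma linfun_dirac_sum (W : vectType C) (F : V -> W) v :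
  (linfun (fun a : A => \sum_v (a v : C) *: F v) : 'Hom({ffun V -> C^o}, W)) (dirac v) = F v.
Proof.
rewrite linfunE_linear; last first.
  move=> k a b; rewrite scaler_sumr -big_split; apply: eq_bigr => w _.
  by rewrite !ffunE /= scalerDl scalerA.
rewrite (bigD1 v) //= ffunE eqxx scale1r big1 ?addr0 // => w wv.
by rewrite ffunE (negPf wv) scale0r.
Qed.

Lemma classical_mdagE v : classical_mdag (dirac v) =
  #|V|%:R *: tpure (dirac v : l2 X) (dirac v : l2 X).
Proof. exact: linfun_dirac_sum. Qed.

Lemma classical_qm_adj : (qm X)^† = classical_mdag.
Proof.
apply: (adj_eq (ogb_tens classical_ogb classical_ogb) classical_ogb) => -[u w] v /=.
rewrite classical_mdagE (ipZl (ogb_hilbert (ogb_tens classical_ogb classical_ogb))) conjC_nat.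
rewrite (ip_tens _ _ _ _ classical_ogb classical_ogb) !ip_dirac (qmE classical_algebra) /=.
by rewrite !ffunE; move: N0; move: (#|V|%:R : C) => N N1; field.
Qed.

Lemma dsq_classical : dsq X = #|V|%:R.
Proof. by rewrite /dsq /= sqr_sqrtr ?ler0n // rmorph_nat. Qed.

End ClassicalSet.

(** * The twist of a classical set by two commuting involutions *)

Section Twist.
Context {R : realType} (V : finType) (s t : V -> V).
Local Notation C := R[i].
Local Notation A := {ffun V -> C^o}.

(** With [a = a_0 + a_1] split by the parity under [s], the product is [a_0 b + a_1 T(b)] written
    pointwise. The involution has to be twisted along with it: it is [conj a_0 + T(conj a_1)]. Unit
    and state are those of the classical set. *)
Definition twist : qset R :=
  @QSet R {ffun V -> C^o}
    (fun a b => [ffun v => ((a v + a (s v) : C) * b v + (a v - a (s v) : C) * b (t v)) / 2])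
    [ffun=> 1]
    (fun a => [ffun v => (Num.conj (a v : C) + Num.conj (a (s v) : C) +
                          Num.conj (a (t v) : C) - Num.conj (a (s (t v)) : C)) / 2])
    (fun a => (\sum_v (a v : C)) / #|V|%:R)
    (Num.sqrt #|V|%:R).

Local Notation X := twist.
Local Notation Y := (classical_set R V).

Hypothesis V0 : (0 < #|V|)%N.
Hypothesis ss : involutive s.
Hypothesis tt : involutive t.
Hypothesis st : forall v, s (t v) = t (s v).

Lemma twist_algebra : unital_algebra (@qmul R X) (qone X).
Proof.
split=> /= [a k b d|b k a d|a b d|a|a]; apply/ffunP=> v; rewrite !ffunE /= ?ss ?tt ?st.
- by rewrite -![k *: (_ : C^o)]/(k * (_ : C)); field.
- by rewrite -![k *: (_ : C^o)]/(k * (_ : C)); field.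
- by rewrite ?ss; field.
- by field.
- by field.
Qed.

Lemma twist_involution : involution (@qmul R X) (@qstar R X).
Proof.
split=> /= [k a b|a b|a]; apply/ffunP=> v; rewrite !ffunE /= ?(ss, tt, st).
- rewrite -![k *: (_ : C^o)]/(k * (_ : C)) !(rmorphD, rmorphM) /=.
  by rewrite -![_ *: (_ : C^o)]/(_ * (_ : C)); field.
- by rewrite !(rmorphD, rmorphM, rmorphN, fmorphV, rmorph_nat) /=; field.
- by rewrite !(rmorphD, rmorphM, rmorphN, fmorphV, rmorph_nat) /= !conjCK; field.
Qed.

(** The twisted [a^* b] equals [conj a_0 b + T(conj a_1 b)], because T commutes with S; the state is
    invariant under T. *)
Lemma ip_twist (a b : A) : ip (a : l2 X) b = ip (a : l2 Y) b.
Proof.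
rewrite ip_classical /ip /=; congr (_ / _).
pose g v : C := Num.conj (a v : C) * b v.
pose h v : C := Num.conj (a (s v) : C) * b v.
rewrite (eq_bigr (fun v => (g v + h v) / 2 + (g (t v) - h (t v)) / 2)); last first.
  move=> v _; rewrite !ffunE /= ?(ss, tt, st) /g /h ?st.
  by field.
rewrite big_split /= [X in _ + X](reindex_inj (inv_inj tt)) /=.
by rewrite -big_split; apply: eq_bigr => v _ /=; rewrite tt /g; field.
Qed.

Lemma twist_ogb : @ogb R (l2 X) V (dirac (R:=R) (V:=V)) #|V|%:R^-1.
Proof.
have [lin cj c0 o sp] := @classical_ogb R V V0.
split=> // [u a v w|u v|v w]; rewrite ?ip_twist //.
Qed.


End Twist.

(** * Homogeneous elements of a twisted set *)

Section TwistedGraphs.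
Context {R : realType} (V : finType) (s t : V -> V).
Local Notation C := R[i].
Local Notation A := {ffun V -> C^o}.
Local Notation X := (@twist R V s t).
Local Notation Y := (classical_set R V).

Hypothesis V0 : (0 < #|V|)%N.
Hypothesis ss : involutive s.
Hypothesis tt : involutive t.
Hypothesis st : forall v, s (t v) = t (s v).

Let N0 : (#|V|%:R : C) != 0.
Proof. by rewrite pnatr_eq0 -lt0n. Qed.

Local Notation d v := (dirac v : A).

Lemma dsq_twist : dsq X = #|V|%:R.
Proof. by rewrite /dsq /= sqr_sqrtr ?ler0n // rmorph_nat. Qed.

(** The projection onto the isotypic component of [s] with eigenvalue [(-1)^k]. *)
Definition iso (k : bool) (a : A) : A :=
  [ffun v => ((a v : C) + (-1) ^+ k * (a (s v) : C)) / 2].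

Definition tpow (k : bool) (v : V) : V := if k then t v else v.

(* [homog k v] is the component of degree [k] of [dirac v] under the action of [s]. *)
Definition homog k v : A := iso k (d v).

Lemma homogE k v w :
  (homog k v w : C) = ((w == v)%:R + (-1) ^+ k * (s w == v)%:R) / 2.
Proof. by rewrite !ffunE. Qed.

Lemma tpowK k : involutive (tpow k).
Proof. by case: k => v //=; rewrite tt. Qed.

Lemma tpow_s k v : tpow k (s v) = s (tpow k v).
Proof. by case: k => //=. Qed.

Lemma homog_tpow k l v w : homog k (tpow l v) w = homog k v (tpow l w).
Proof.
apply: (etrans (homogE _ _ _)); rewrite homogE -tpow_s.
by rewrite -!(inj_eq (can_inj (tpowK l)) _ (tpow l v)) tpowK.
Qed.

Lemma dirac_homog v : d v = homog false v + homog true v.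
Proof.
by apply/ffunP => w; rewrite [RHS]ffunE -[RHS]/((_ : C) + (_ : C)) !homogE ffunE; field.
Qed.

Lemma spans_homog : spans (fun p : bool * V => homog p.1 p.2).
Proof.
move=> a; exists (fun p => a p.2).
rewrite -(pair_big xpredT xpredT (fun k v => (a v : C) *: homog k v)) /=.
rewrite exchange_big /= {1}[a]ffun_expand; apply: eq_bigr => v _.
by rewrite big_bool /= -scalerDr addrC -dirac_homog.
Qed.

Lemma homog_sV k v : homog k (s v) = (-1) ^+ k *: homog k v.
Proof.
apply/ffunP => w; rewrite [RHS]ffunE; apply: (etrans (homogE _ _ _)).
rewrite -[RHS]/(_ * (_ : C)) homogE (inj_eq (inv_inj ss)) -[in w == _](ss w) (inj_eq (inv_inj ss)).
by case: k; rewrite /= ?expr1 ?expr0; field.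
Qed.

Lemma iso_s k (a : A) v : (iso k a (s v) : C) = (-1) ^+ k * iso k a v.
Proof. by rewrite !ffunE ss; case: k; rewrite ?expr1 ?expr0; field. Qed.

Lemma twist_mul_iso k (a b : A) v :
  (@qmul R X (iso k a) b v : C) = (iso k a v : C) * b (tpow k v).
Proof.
rewrite ffunE iso_s; move: (iso k a v : C) => x.
by case: k; rewrite /= ?expr1 ?expr0; field.
Qed.

Lemma twist_mul_homog k u l w : @qmul R X (homog k u) (homog l w) =
  @qmul R Y (homog k u) (homog l (tpow k w)).
Proof.
by apply/ffunP => v; rewrite [RHS]ffunE homog_tpow; apply: twist_mul_iso.
Qed.

Lemma iso_homog k l v : iso k (homog l v) = if k == l then homog k v else 0.
Proof.
apply/ffunP => w; rewrite ffunE iso_s; move: (iso_s l (d v) w).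
case: eqP => [->|kl]; rewrite ?[in RHS]ffunE -?/(homog l v).
  by move: (homog l v w : C) => x; case: l; rewrite ?expr1 ?expr0 => _; field.
move: (homog l v w : C) => x.
case: k l kl => [] [] //=; rewrite ?expr1 ?expr0 => _ _; rewrite ffunE; by field.
Qed.

Let hY := ogb_hilbert (@classical_ogb R V V0).

Lemma ip_homog k v (a : A) : ip (homog k v : l2 Y) a = (iso k a v : C) / #|V|%:R.
Proof.
have -> : homog k v = 2^-1 *: (d v + (-1) ^+ k *: d (s v)).
  apply/ffunP => w; apply: (etrans (homogE _ _ _)); rewrite !ffunE.
  rewrite -[RHS]/(_ * (_ + _ * _)) -[in s w == _](ss v) (inj_eq (inv_inj ss)).
  by rewrite mulrC.
rewrite (ipZl hY) (ipDl hY) (ipZl hY) !ip_dirac ffunE.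
rewrite fmorphV rmorph_sign /= conjC_nat.
by move: N0; move: (#|V|%:R : C) => N N1; field.
Qed.

Lemma ip_homog2 k v l w : ip (homog k v : l2 Y) (homog l w) =
  (if k == l then homog l w v : C else 0) / #|V|%:R.
Proof.
by rewrite ip_homog iso_homog; case: eqP => [->|_] //; rewrite ffunE.
Qed.

(** Splitting the first leg of the classical [|V| d_v ⊗ d_v] into degrees [l], the second leg is
    moved by [t^l] so that the shift in the twisted product is undone. *)
Definition twist_mdag : 'Hom(l2 X, tens (l2 X) (l2 X)) :=
  linfun (fun a : A => \sum_v (a v : C) *:
    (\sum_l #|V|%:R *: tpure (homog l v : l2 X) (d (tpow l v) : l2 X)) : tens (l2 X) (l2 X)).

Lemma twist_mdag_dirac v : twist_mdag (d v) =
  \sum_l #|V|%:R *: tpure (homog l v : l2 X) (d (tpow l v) : l2 X).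
Proof. exact: linfun_dirac_sum. Qed.

Let oX : @ogb R (l2 X) V (dirac (R:=R) (V:=V)) #|V|%:R^-1 := twist_ogb V0 ss tt st.
Let ip_tw (a b : A) : ip (a : l2 X) b = ip (a : l2 Y) b := ip_twist ss tt st a b.

Lemma twist_qm_adj : (qm X)^† = twist_mdag.
Proof.
apply: (adj_eq (ogb_tens oX oX) oX) => -[u w] v /=.
rewrite twist_mdag_dirac (ogb_ip_suml (ogb_tens oX oX)) (qmE (twist_algebra ss tt st)).
under eq_bigr do rewrite (ip_tens _ _ _ _ oX oX) !ip_tw ip_homog ip_dirac conjC_nat.
rewrite ip_tw ip_dirac big_bool /= !ffunE /=.
by rewrite expr0 expr1; move: N0; move: (#|V|%:R : C) => N N1; field.
Qed.

Lemma homog_dirac k v : homog k v = 2^-1 *: (d v) + ((-1) ^+ k / 2) *: d (s v).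
Proof.
apply/ffunP => w; apply: (etrans (homogE _ _ _)); rewrite !ffunE.
rewrite -[RHS]/(_ * _ + _ / _ * _) -[in s w == _](ss v) (inj_eq (inv_inj ss)).
by field.
Qed.

(** Moving [v] to [s v] multiplies the first leg by [(-1)^l]; averaging with the sign [(-1)^k]
    therefore projects the second leg to degree [k + l]. *)
Lemma twist_mdagE k v : twist_mdag (homog k v) =
  \sum_l #|V|%:R *: tpure (homog l v : l2 X) (homog (k (+) l) (tpow l v) : l2 X).
Proof.
rewrite homog_dirac linearD !linearZ /= !twist_mdag_dirac !scaler_sumr -big_split.
apply: eq_bigr => l _ /=; rewrite tpow_s homog_sV (homog_dirac (_ (+) _)).
rewrite !tpureE !scalerDr !scalerA.
by congr (_ *: _ + _ *: _); rewrite ?signr_addb; field.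
Qed.

(** Put in the form of [twist_mdagE]: the two comultiplications differ only by [tpow l] on the
    second leg, which the quantum isomorphism absorbs. *)
Lemma classical_mdag_homog k v : classical_mdag V (homog k v) =
  \sum_l #|V|%:R *: tpure (homog l v : l2 Y) (homog (k (+) l) v : l2 Y).
Proof.
have dd w : tpure (d w : l2 Y) (d w : l2 Y) =
    \sum_l tpure (homog l w : l2 Y) (d w : l2 Y).
  by rewrite big_bool /= -tpureDl addrC -dirac_homog.
rewrite homog_dirac linearD !linearZ /= !classical_mdagE !dd !scaler_sumr -big_split.
apply: eq_bigr => l _ /=; rewrite homog_sV (homog_dirac (_ (+) _)).
rewrite !tpureE !scalerDr !scalerA.
by congr (_ *: _ + _ *: _); rewrite ?signr_addb; field.
Qed.

End TwistedGraphs.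

(** * The quantum isomorphism between a set and its twist *)

Section QuantumIsomorphism.
Context {R : realType} (V : finType) (s t : V -> V).
Local Notation C := R[i].
Local Notation A := {ffun V -> C^o}.
Local Notation X := (@twist R V s t).
Local Notation Y := (classical_set R V).
Local Notation H := (l2 (classical_set R bool)).
Local Notation h c := (dirac c : {ffun bool -> C^o}).
Local Notation hom := (@homog R V s).
Local Notation tp := (tpow t).

Hypothesis V0 : (0 < #|V|)%N.
Hypothesis ss : involutive s.
Hypothesis tt : involutive t.
Hypothesis st : forall v, s (t v) = t (s v).

Let N0 : (#|V|%:R : C) != 0.
Proof. by rewrite pnatr_eq0 -lt0n. Qed.

Let bool0 : (0 < #|{: bool}|)%N. Proof. by rewrite card_bool. Qed.

Let oX : @ogb R (l2 X) V (dirac (R:=R) (V:=V)) #|V|%:R^-1 := twist_ogb V0 ss tt st.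
Let oY : @ogb R (l2 Y) V (dirac (R:=R) (V:=V)) #|V|%:R^-1 := classical_ogb V0.
Let oH := @classical_ogb R bool bool0.
Let algX := @twist_algebra R V s t ss tt st.
Let algY := @classical_algebra R V.
Let starX := @twist_involution R V s t ss tt st.
Let starY := @classical_involution R V.

(** A vector of bidegree [(k, l)] is sent past [H] while [X^k Z^l] acts on [H]. In the basis [h c],
    [Z^l] is the sign [(-1)^(c l)], that is the shift by [t^c], and [X^k] sends [h c] to
    [h (c + k)]. Dirac functions are used because the homogeneous family is redundant; [isoPE] is
    the working form. *)
Definition isoP : 'Hom(tens H (l2 X), tens (l2 Y) H) :=
  tlift (fun (x : H) (a : l2 X) => \sum_c \sum_v
    (((x : {ffun bool -> C^o}) c : C) * ((a : A) v : C)) *: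
    \sum_i tpure (hom i (tp c v) : l2 Y) (h (c (+) i) : H) : tens (l2 Y) H).

Lemma isoP_dirac c v : isoP (tpure (h c : H) (dirac v : l2 X)) =
  \sum_i tpure (hom i (tp c v) : l2 Y) (h (c (+) i) : H).
Proof.
rewrite /isoP tliftE; last first.
  split=> [x k a b|a k x y].
    rewrite scaler_sumr -big_split; apply: eq_bigr => b' _ /=.
    rewrite scaler_sumr -big_split; apply: eq_bigr => w _ /=.
    rewrite !ffunE scalerA -scalerDl; congr (_ *: _).
    by rewrite mulrDr; congr (_ + _); apply: mulrCA.
  rewrite scaler_sumr -big_split; apply: eq_bigr => b' _ /=.
  rewrite scaler_sumr -big_split; apply: eq_bigr => w _ /=.
  rewrite !ffunE scalerA -scalerDl; congr (_ *: _).
  by rewrite mulrDl; congr (_ + _); rewrite -[LHS]mulrA.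
rewrite (bigD1 c) //= [X in _ + X]big1 ?addr0 => [|b bc]; last first.
  by rewrite big1 // => w _; rewrite !ffunE (negPf bc) mul0r scale0r.
rewrite (bigD1 v) //= [X in _ + X]big1 ?addr0 => [|w wv]; last first.
  by rewrite !ffunE (negPf wv) mulr0 scale0r.
by rewrite !ffunE !eqxx mulr1 scale1r.
Qed.

Lemma isoPE c k v : isoP (tpure (h c : H) (hom k v : l2 X)) =
  tpure (hom k (tp c v) : l2 Y) (h (c (+) k) : H).
Proof.
rewrite (homog_dirac ss) tpureDr !tpureZr linearD !linearZ /= !isoP_dirac !scaler_sumr.
rewrite -big_split (bigD1 k) //= big1 => [|i ik].
  rewrite (tpow_s st) (homog_sV ss) tpureZl scalerA -scalerDl addr0.
  rewrite mulrAC -signr_addb addbb expr0 (_ : 2^-1 + 1 / 2 = 1 :> C) ?scale1r //.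
  by field.
rewrite (tpow_s st) (homog_sV ss) tpureZl scalerA -scalerDl mulrAC -signr_addb.
rewrite (_ : k (+) i = true); last by case: k i ik => [] [].
by rewrite expr1 mulN1r subrr scale0r.
Qed.

Lemma isoP_homogeneous (c k : bool) (a : A) :
  (forall v, (a (s v) : C) = (-1) ^+ k * a v) ->
  isoP (tpure (h c : H) (a : l2 X)) =
  tpure ([ffun v => a (tp c v)] : l2 Y) (h (c (+) k) : H).
Proof.
(* The projection to degree [k] fixes [a], so projecting its Dirac expansion gives [a] back. *)
move=> ak; have aE : a = \sum_v (a v : C) *: hom k v.
  have pick (f : V -> C) w : \sum_v f v * (w == v)%:R = f w.
    rewrite (bigD1 w) //= eqxx mulr1 big1 ?addr0 // => v vw.
    by rewrite eq_sym (negPf vw) mulr0.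
  apply/ffunP => w; rewrite sum_ffunE.
  rewrite (eq_bigr (fun v => 2^-1 * ((a v : C) * (w == v)%:R) +
      (-1) ^+ k / 2 * ((a v : C) * (s w == v)%:R))); last first.
    move=> v _; rewrite ffunE -[LHS]/((a v : C) * (_ : C)) homogE.
    by move: (a v : C) => x; field.
  rewrite big_split /= -!mulr_sumr !pick ak.
  by move: (a w : C) => x; case: (k); rewrite ?expr0 ?expr1; field.
rewrite {1}aE tpure_sumr lfun_sumZ.
under eq_bigr do rewrite isoPE.
rewrite -tpure_suml; congr (tpure _ _); apply/ffunP => w.
rewrite ffunE [in RHS]aE !sum_ffunE; apply: eq_bigr => v _.
rewrite [LHS]ffunE [RHS]ffunE; congr (_ *: _); exact: homog_tpow.
Qed.

Lemma spans_tens_homog : spans (fun p : bool * (bool * V) =>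
  tpure (h p.1 : H) (hom p.2.1 p.2.2 : l2 X)).
Proof.
apply: (spans_tens (e := fun c : bool => h c : H)
  (f := fun p : bool * V => hom p.1 p.2 : l2 X)).
  exact: spans_dirac.
exact: (spans_homog s).
Qed.

Lemma twist_tens_eq (W : vectType C) (f g : 'Hom(tens H (l2 X), W)) :
  (forall c k v, f (tpure (h c : H) (hom k v : l2 X)) = g (tpure (h c : H) (hom k v : l2 X))) ->
  f = g.
Proof. by move=> fg; apply: (spans_eq spans_tens_homog) => -[c [k v]]; apply: fg. Qed.

Lemma isoP_comult :
  (qm Y)^† ⊗ \1 \o isoP =
    assocI _ _ _ \o (\1 ⊗ isoP) \o assoc _ _ _ \o (isoP ⊗ \1) \o assocI _ _ _ \o
    (\1 ⊗ (qm X)^†).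
Proof.
apply: twist_tens_eq => c k v; rewrite !comp_lfunE isoPE !tmapE !id_lfunE.
rewrite (classical_qm_adj V0) (classical_mdag_homog ss) (twist_qm_adj V0 ss tt st).
rewrite (twist_mdagE ss st) tpure_suml tpure_sumr !lfun_sumZ; apply: eq_bigr => l _.
congr (_ *: _); rewrite assocIE tmapE isoPE id_lfunE assocE tmapE id_lfunE isoPE assocIE.
(* The first leg has moved [H] to [h (c + l)], so the second is shifted by [t^(c + l)]; the [t^l] in
   the twisted comultiplication cancels the excess. *)
have -> : tp (c (+) l) (tp l v) = tp c v by case: c; case: l; rewrite /= ?tt.
by rewrite addbACA addbb addbF.
Qed.

Lemma isoP_counit :
  lunit H \o ((qi Y)^† ⊗ \1) \o isoP = runit H \o (\1 ⊗ (qi X)^†).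
Proof.
apply: twist_tens_eq => c k v; rewrite !comp_lfunE isoPE !tmapE !id_lfunE lunitE runitE.
rewrite (qi_adjE oY algY starY) (qi_adjE oX algX starX) /=.
(* The state kills degree one, the only degree that flips the basis of [H], and takes the same value
   at [v] and at [t^c v]. *)
have psi (m : bool) w : \sum_x (hom m w x : C) = (~~ m)%:R.
  under eq_bigr do rewrite homogE.
  rewrite -mulr_suml big_split -mulr_sumr /= (bigD1 w) //= eqxx big1 => [|x /negPf -> //].
  rewrite (bigD1 (s w)) //= ss eqxx big1 => [|x xw].
    by case: m => /=; rewrite ?expr1 ?expr0; field.
  by rewrite -(inj_eq (inv_inj ss)) ss in xw; rewrite (negPf xw).
by rewrite !psi; case: k; rewrite ?mul0r ?scale0r ?addbF.
Qed.

(** The left factor, of degree [k], changes [h c] into [h (c + k)], so the right factor is shifted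
    by [t^(c + k)]. The extra [t^k] is the twist of the product. *)
Lemma isoP_mult :
  isoP \o (\1 ⊗ qm X) =
    (qm Y ⊗ \1) \o assocI _ _ _ \o (\1 ⊗ isoP) \o assoc _ _ _ \o
    (isoP ⊗ \1) \o assocI _ _ _.
Proof.
pose e (p : bool * (bool * V * (bool * V))) := tpure (h p.1 : H)
  (tpure (hom p.2.1.1 p.2.1.2 : l2 X) (hom p.2.2.1 p.2.2.2 : l2 X)).
have se : spans e.
  apply: (spans_tens (e := fun c : bool => h c : H)
    (f := fun p : bool * V * (bool * V) =>
       tpure (hom p.1.1 p.1.2 : l2 X) (hom p.2.1 p.2.2 : l2 X))).
    exact: spans_dirac.
  exact: (spans_tens (U := l2 X) (V := l2 X) (spans_homog s) (spans_homog s)).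
apply: (spans_eq se) => -[c [[k u] [l w]]]; rewrite /e !comp_lfunE !tmapE /= !id_lfunE.
rewrite assocIE !tmapE isoPE id_lfunE assocE tmapE id_lfunE isoPE assocIE tmapE id_lfunE.
have mulX := etrans (qmE algX (hom k u) (hom l w)) (twist_mul_homog ss tt st k u l w).
have mulY := qmE algY (hom k (tp c u)) (hom l (tp (c (+) k) w)).
apply: (etrans (congr1 (fun z : l2 X => isoP (tpure (h c : H) z)) mulX)).
apply: (etrans _ (congr1 (fun z : l2 Y => tpure z (h _ : H)) (esym mulY))).
have hs (k' : bool) x v : (hom k' x (s v) : C) = (-1) ^+ k' * hom k' x v := iso_s ss k' _ v.
rewrite (@isoP_homogeneous _ (k (+) l)) => [|v]; last first.
  by rewrite [LHS]ffunE [X in _ = _ * X]ffunE !hs signr_addb mulrACA.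
rewrite addbA; congr (tpure _ _); apply/ffunP => v; rewrite ffunE [LHS]ffunE [RHS]ffunE.
rewrite !(homog_tpow tt st).
have -> : tp (c (+) k) v = tp k (tp c v).
  clear mulX mulY; by case: c; case: k; rewrite /= ?tt.
by [].
Qed.

Lemma one_homog : qone X = \sum_v hom false v.
Proof.
apply/ffunP => w; rewrite ffunE sum_ffunE.
under eq_bigr do rewrite homogE expr0 mul1r.
rewrite -mulr_suml big_split /= (bigD1 w) //= eqxx big1 => [|v /negPf vw]; last first.
  by rewrite eq_sym vw.
rewrite (bigD1 (s w)) //= eqxx big1 => [|v /negPf vw]; last by rewrite eq_sym vw.
by rewrite !addr0 -mulr2n mulfV // pnatr_eq0.
Qed.

Lemma isoP_unit : isoP \o (\1 ⊗ qi X) \o runitI H = (qi Y ⊗ \1) \o lunitI H.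
Proof.
apply: (spans_eq (V := H) (e := fun c : bool => h c : H)); first exact: spans_dirac.
move=> c; rewrite !comp_lfunE runitIE lunitIE !tmapE.
rewrite !id_lfunE !qiE !scale1r.
have one1 : qone X = \sum_v (1 : C) *: hom false v.
  by rewrite one_homog; apply: eq_bigr => v _; rewrite scale1r.
apply: (etrans (congr1 (fun z : l2 X => isoP (tpure (h c : H) z)) one1)).
apply: (etrans _ (congr1 (fun z : l2 Y => tpure z (h c : H)) (esym one1))).
rewrite tpure_sumr lfun_sumZ tpure_suml.
rewrite [RHS](reindex_inj (inv_inj (tpowK tt c))) /=; apply: eq_bigr => v _.
by rewrite isoPE addbF.
Qed.

(** On homogeneous tensors the diagram inverts the formula [isoPE], so the identity says that [isoP]
    is unitary. *)
Lemma isoP_adj :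
  isoP^† = lunit _ \o (ev Y ⊗ \1) \o assocI _ _ _ \o (\1 ⊗ assoc _ _ _) \o
            (\1 ⊗ (isoP ⊗ \1)) \o (\1 ⊗ assocI _ _ _) \o
            (\1 ⊗ (\1 ⊗ coev X)) \o (\1 ⊗ runitI H).
Proof.
have sYH : spans (fun p : bool * V * bool =>
    tpure (hom p.1.1 p.1.2 : l2 Y) (h p.2 : H)).
  apply: (spans_tens (e := fun p : bool * V => hom p.1 p.2 : l2 Y)
    (f := fun c : bool => h c : H)); first exact: (spans_homog s).
  exact: spans_dirac.
apply: (adj_eq_spans (ogb_tens oH oX) (ogb_tens oY oH) spans_tens_homog sYH).
move=> [c' [k' v']] [[k v] c] /=.
have -> : (lunit _ \o (ev Y ⊗ \1) \o assocI _ _ _ \o (\1 ⊗ assoc _ _ _) \o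
            (\1 ⊗ (isoP ⊗ \1)) \o (\1 ⊗ assocI _ _ _) \o
            (\1 ⊗ (\1 ⊗ coev X)) \o (\1 ⊗ runitI H)) (tpure (hom k v : l2 Y) (h c : H)) =
    tpure (h (c (+) k) : H) (hom k (tp (c (+) k) v) : l2 X).
  rewrite !comp_lfunE !tmapE !id_lfunE runitIE !tmapE !id_lfunE.
  rewrite /coev comp_lfunE qiE scale1r (twist_qm_adj V0 ss tt st).
  have one1 : qone X = \sum_v (1 : C) *: (dirac v : A).
    by rewrite [LHS]ffun_expand; apply: eq_bigr => w _; rewrite ffunE.
  apply: (etrans (congr1 (fun z : l2 X => lunit _ ((ev Y ⊗ \1) (assocI _ _ _
    (tpure (hom k v : l2 Y) (assoc _ _ _ ((isoP ⊗ \1) (assocI _ _ _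
      (tpure (h c : H) (twist_mdag s t z))))))))) one1)).
  rewrite lfun_sumZ tpure_sumr !lfun_sumZ tpure_sumr !lfun_sumZ.
  (* The target is expanded in Dirac functions reindexed by [t^k], to match term by term the sum
     over points coming from [coev]. *)
  have -> : hom k (tp (c (+) k) v) = \sum_w (hom k v (tp c w) : C) *: (dirac (tp k w) : A).
    rewrite [LHS]ffun_expand (reindex_inj (inv_inj (tpowK tt k))) /=.
    apply: eq_bigr => w _; congr (_ *: _); rewrite (homog_tpow tt st); congr (hom _ _ _).
    by case: c; case: k; rewrite /= ?tt.
  rewrite tpure_sumr; apply: eq_bigr => w _; rewrite scale1r.
  rewrite twist_mdag_dirac tpure_sumr !lfun_sumZ tpure_sumr !lfun_sumZ.
  have step l : lunit _ ((ev Y ⊗ \1) (assocI _ _ _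
    (tpure (hom k v : l2 Y) (assoc _ _ _ ((isoP ⊗ \1) (assocI _ _ _
      (tpure (h c : H) (tpure (hom l w : l2 X) (dirac (tp l w) : l2 X))))))))) =
    (if l == k then (hom k v (tp c w) : C) / #|V|%:R else 0) *:
      tpure (h (c (+) l) : H) (dirac (tp l w) : l2 X).
    rewrite assocIE tmapE isoPE !id_lfunE assocE assocIE tmapE id_lfunE lunitE.
    congr (_ *: _); rewrite /ev comp_lfunE (qi_adjE oY algY starY) (qmE algY) /=.
    have := @ip_homog2 R V s V0 ss l (tp c w) k v; rewrite ip_classical.
    (* Homogeneous vectors are real-valued, so the bilinear pairing [ev] agrees on them with the
       inner product, and degrees [l] other than [k] drop out. *)
    have cr l' x y : Num.conj (hom l' x y : C) = hom l' x y.
      by rewrite homogE rmorphM rmorphD rmorphM fmorphV rmorph_sign /= !conjC_nat.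
    rewrite (eq_bigr (fun x => (hom k v x : C) * (hom l (tp c w) x : C))) => [|x _];
      last by rewrite cr mulrC.
    rewrite (fun_if (fun z => z / _)) mul0r => <-.
    by congr (_ / _); apply: eq_bigr => x _; rewrite ffunE.
  rewrite (bigD1 k) //= big1 ?addr0 => [|l lk]; rewrite step; last first.
    by rewrite (negPf lk) scale0r scaler0.
  by rewrite eqxx scalerA mulrCA mulfV // mulr1.
rewrite isoPE (ip_tens _ _ _ _ oY oH) (ip_tens _ _ _ _ oH oX).
rewrite (ip_twist ss tt st) !(ip_homog2 V0 ss) !ip_dirac.
have dE (a b : bool) : (h a b : C) = (b == a)%:R by rewrite ffunE.
rewrite !dE; case: eqP => [<-|_]; last by rewrite !mul0r mulr0.
rewrite (homog_tpow tt st).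
have -> : (c == c' (+) k) = (c (+) k == c') by case: (c); case: (c'); case: (k).
by case: eqP => [<-|_]; rewrite ?mul0r ?mulr0 //; apply: mulrC.
Qed.

Lemma isoP_graph (T : 'End(l2 X)) (T' : 'End(l2 Y)) (f : V -> A) :
  (forall v x, f (t v) (t x) = f v x) ->
  (forall k v, T (hom k v) = iso s k (f v)) ->
  (forall k v, T' (hom k v) = iso s k (f v)) ->
  isoP \o (\1 ⊗ T) = (T' ⊗ \1) \o isoP.
Proof.
move=> ft TE TE'; apply: twist_tens_eq => c k v.
rewrite !comp_lfunE tmapE isoPE tmapE !id_lfunE TE TE'.
rewrite (@isoP_homogeneous _ k) => [|w]; last exact: iso_s.
congr (tpure _ _); apply/ffunP => w; rewrite !ffunE.
by case: (c) => //=; rewrite st -(ft v (t w)) -(ft v (t (s w))) !tt.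
Qed.

End QuantumIsomorphism.

(** * Twisted graphs *)

Section TwistedGraphProperties.
Context {R : realType} (V : finType) (s t : V -> V) (e : rel V).
Local Notation C := R[i].
Local Notation A := {ffun V -> C^o}.
Local Notation X := (@twist R V s t).
Local Notation Y := (classical_set R V).
Local Notation hom := (@homog R V s).

Hypothesis V0 : (0 < #|V|)%N.
Hypothesis ss : involutive s.
Hypothesis tt : involutive t.
Hypothesis st : forall v, s (t v) = t (s v).
Hypothesis es : forall u v, e (s u) (s v) = e u v.
Hypothesis et : forall u v, e (t u) (t v) = e u v.

Let N0 : (#|V|%:R : C) != 0.
Proof. by rewrite pnatr_eq0 -lt0n. Qed.

Let oX : @ogb R (l2 X) V (dirac (R:=R) (V:=V)) #|V|%:R^-1 := twist_ogb V0 ss tt st.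
Let oY : @ogb R (l2 Y) V (dirac (R:=R) (V:=V)) #|V|%:R^-1 := classical_ogb V0.
Let algX := @twist_algebra R V s t ss tt st.
Let algY := @classical_algebra R V.
Let starX := @twist_involution R V s t ss tt st.
Let starY := @classical_involution R V.

(** The formula of [adjacency], retyped: the twist has the same underlying space. *)
Definition twist_adjacency : 'End(l2 X) :=
  linfun (fun f : A => [ffun v => \sum_(w | e v w) f w]).

Lemma adjacency_linear :
  linear (fun f : A => [ffun v => \sum_(w | e v w) f w] : A).
Proof.
move=> k f g; apply/ffunP => v; rewrite !ffunE scaler_sumr -big_split.
by apply: eq_bigr => w _; rewrite !ffunE.
Qed.

Lemma adjacencyE (f : A) v : (adjacency R e f : A) v = \sum_(w | e v w) f w.
Proof. by rewrite /adjacency linfunE_linear ?ffunE //; apply: adjacency_linear. Qed.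

Lemma twist_adjacencyE (f : A) : twist_adjacency f = adjacency R e f.
Proof.
exact: etrans (linfunE_linear adjacency_linear f) (esym (linfunE_linear adjacency_linear f)). Qed.

Definition adj_col (v : V) : A := [ffun x => (e x v)%:R].

Lemma adjacency_homog k v : adjacency R e (hom k v) = iso s k (adj_col v).
Proof.
apply/ffunP => x; rewrite adjacencyE; under eq_bigr do rewrite homogE.
have pick u : \sum_(w | e x w) (w == u)%:R = (e x u)%:R :> C.
  case exu: (e x u); last first.
    by rewrite big1 // => w xw; case: eqP => // wu; rewrite -wu xw in exu.
  by rewrite (bigD1 u) //= eqxx big1 ?addr0 // => w /andP[_ /negPf ->].
rewrite -mulr_suml big_split -mulr_sumr /= pick.
under [X in _ + _ * X]eq_bigr => w _ do rewrite -(inj_eq (inv_inj ss)) ss.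
by rewrite pick !ffunE -(es x (s v)) ss.
Qed.

Lemma iso_conv k (f g : A) v :
  \sum_l (iso s l f v : C) * iso s (k (+) l) g v = iso s k [ffun x => (f x : C) * g x] v.
Proof.
rewrite big_bool /= !ffunE.
by case: k; rewrite /= ?expr0 ?expr1; field.
Qed.

(** The comultiplication shifts the second leg by [t^l] and the product shifts it back. A
    [t]-invariant kernel [g] lets the two meet, so the Schur product is the entrywise product of
    kernels, as in the classical case. *)
Lemma twist_schur (S T : 'End(l2 X)) (f g : V -> A) :
  (forall v x, g (t v) (t x) = g v x) ->
  (forall k v, S (hom k v) = iso s k (f v)) ->
  (forall k v, T (hom k v) = iso s k (g v)) ->
  forall k v, schur S T (hom k v) = iso s k [ffun x => (f v x : C) * g v x].
Proof.
move=> gt SE TE k v; rewrite /schur scale_lfunE !comp_lfunE (twist_qm_adj V0 ss tt st).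
rewrite (twist_mdagE ss st) !lfun_sumZ scaler_sumr; apply/ffunP => x.
rewrite -iso_conv sum_ffunE; apply: eq_bigr => l _.
rewrite scalerA dsq_twist mulVf // scale1r tmapE SE TE (qmE algX).
rewrite (twist_mul_iso t ss) !ffunE /=; congr (_ * (_ / _)).
by case: l => //=; rewrite st -(gt v x) -(gt v (s x)).
Qed.

Lemma twist_finite_quantum_set : finite_quantum_set X.
Proof.
apply: (finite_quantum_setP oX algX starX _ _ (twist_qm_adj V0 ss tt st)).
- by rewrite /=; under eq_bigr do rewrite ffunE; rewrite sumr_const divff.
- by rewrite /= sqrtr_gt0 ltr0n.
move=> a; have: qm X \o twist_mdag s t = dsq X *: \1; last first.
  by move/(congr1 (fun f : 'End(l2 X) => f a)); rewrite comp_lfunE scale_lfunE id_lfunE.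
apply: (spans_eq (V := l2 X) (e := fun p : bool * V => hom p.1 p.2 : l2 X)).
  exact: (spans_homog s).
move=> [k v]; rewrite comp_lfunE scale_lfunE id_lfunE /= (twist_mdagE ss st) lfun_sumZ.
rewrite -scaler_sumr dsq_twist; congr (_ *: _); apply/ffunP => x; rewrite sum_ffunE.
transitivity (\sum_l (iso s l (dirac v) x : C) * iso s (k (+) l) (dirac v) x).
  apply: eq_bigr => l _; rewrite (qmE algX) (twist_mul_iso t ss); congr (_ * _).
  by rewrite -(homog_tpow tt st) tpowK.
rewrite iso_conv; congr (iso s k _ x); apply/ffunP => y; rewrite !ffunE.
by case: (y == v); rewrite ?mulr1 ?mulr0.
Qed.

Lemma twist_quantum_graph : quantum_graph twist_adjacency.
Proof.
split; first exact: twist_finite_quantum_set.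
apply: (spans_eq (V := l2 X) (e := fun p : bool * V => hom p.1 p.2 : l2 X)).
  exact: (spans_homog s).
have TE k v : twist_adjacency (hom k v) = iso s k (adj_col v).
  by rewrite twist_adjacencyE adjacency_homog.
move=> [k v] /=; rewrite (twist_schur (f := adj_col) (g := adj_col)) // ?TE.
  congr iso; apply/ffunP => x; rewrite !ffunE.
  by case: (e x v); rewrite ?mulr1 ?mulr0.
by move=> u x; rewrite !ffunE et.
Qed.

Lemma twist_irreflexive : irreflexive e -> irreflexive_qg twist_adjacency.
Proof.
move=> ei.
have TE k v : twist_adjacency (hom k v) = iso s k (adj_col v).
  by rewrite twist_adjacencyE adjacency_homog.
have IE k v : (\1 : 'End(l2 X)) (hom k v) = iso s k (dirac v) by rewrite id_lfunE.
have col0 (a : A) k : (forall x, a x = 0) -> iso s k a = 0.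
  by move=> a0; apply/ffunP => x; rewrite !ffunE !a0 mulr0 addr0 mul0r.
have dt v x : dirac (t v) (t x) = dirac v x :> C by rewrite !ffunE (inj_eq (inv_inj tt)).
have ct v x : adj_col (t v) (t x) = adj_col v x by rewrite !ffunE et.
split; apply: (spans_eq (V := l2 X) (e := fun p : bool * V => hom p.1 p.2 : l2 X));
  try exact: (spans_homog s); move=> [k v] /=; rewrite zero_lfunE.
  rewrite (twist_schur (f := adj_col) (g := dirac (R := R) (V := V))) //.
  apply: col0 => x; rewrite !ffunE; case: eqP => [->|_]; rewrite ?mulr0 //.
  by rewrite ei mul0r.
rewrite (twist_schur (f := dirac (R := R) (V := V)) (g := adj_col)) //.
apply: col0 => x; rewrite !ffunE; case: eqP => [->|_]; rewrite ?mul0r //.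
by rewrite ei mulr0.
Qed.

(** At [x], the product of the Dirac functions at [x] and [t x] is [1/2], and in the other order it
    is 0. *)
Lemma twist_noncommutative x : s x != x -> t x != x -> s x != t x -> noncommutative X.
Proof.
move=> sx tx sxt XC; have := congr1 (fun a : A => (a x : C)) (XC (dirac x) (dirac (t x))).
rewrite /= !ffunE eqxx [x == t x]eq_sym !(negPf sx, negPf tx, negPf sxt) eqxx.
rewrite !(mulr0n, mulr1n) !(addr0, subr0, mulr0, mul0r, mulr1, add0r) mul1r => /eqP.
by rewrite invr_eq0 pnatr_eq0.
Qed.

Lemma twist_quantum_isomorphic : quantum_isomorphic twist_adjacency (adjacency R e).
Proof.
have b0 : (0 < #|{: bool}|)%N by rewrite card_bool.
exists (l2 (classical_set R bool)); split; first exact: (ogb_hilbert (classical_ogb b0)).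
  by rewrite dimvf /dim /= card_bool.
exists (isoP s t); split; [exact: isoP_comult|exact: isoP_counit|exact: isoP_adj|].
split; [exact: isoP_mult|exact: isoP_unit|].
apply: (isoP_graph ss tt st (f := adj_col)).
- by move=> v x; rewrite !ffunE et.
- by move=> k v; rewrite twist_adjacencyE adjacency_homog.
- exact: adjacency_homog.
Qed.

(** The twist preserves dimension, unit, state and [dsq], hence also [J] and the complement, as maps
    on functions. *)
Lemma twist_strongly_regular n (k lambda mu : C) :
  strongly_regular (adjacency R e) n k lambda mu ->
  strongly_regular twist_adjacency n k lambda mu.
Proof.
move=> [dimn TT]; split; first exact: dimn.
have expand (Z : qset R) (S : 'End(l2 Z)) (b : l2 Z) :
    (lambda *: S + mu *: compl_qg S + k *: \1%VF) b = lambda *: S b + mu *: compl_qg S b + k *: b.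
  by rewrite 2!add_lfunE 3!scale_lfunE id_lfunE.
apply/lfunP => a; have H := congr1 (fun f : 'End(l2 Y) => f a) TT.
rewrite comp_lfunE expand in H.
rewrite comp_lfunE expand.
(* [F] is stated on plain functions, so that an equation can pass between the two operator types. *)
pose F (x y z : A) : A := lambda *: x + mu *: y + k *: z.
have {}H : adjacency R e (adjacency R e a) = F (adjacency R e a) (compl_qg (adjacency R e) a) a.
  exact: H.
have Ta := twist_adjacencyE a.
have TTa := etrans (congr1 (fun z : l2 X => twist_adjacency z) Ta) (twist_adjacencyE _).
have Ca : compl_qg twist_adjacency a = compl_qg (adjacency R e) a.
  apply: etrans (compl_qgE oX algX starX _ _) _.
  apply: etrans _ (esym (compl_qgE oY algY starY _ _)).
  rewrite dsq_twist dsq_classical Ta; reflexivity.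
have TF : F (twist_adjacency a) (compl_qg twist_adjacency a) a =
    twist_adjacency (twist_adjacency a).
  apply: esym; apply: etrans TTa _; apply: etrans H _.
  exact: esym (congr2 (fun x y => F x y a) Ta Ca).
exact: esym TF.
Qed.

Theorem twisted_graph x n (k lambda mu : C) :
  irreflexive e -> s x != x -> t x != x -> s x != t x ->
  strongly_regular (adjacency R e) n k lambda mu ->
  exists (X : qset R) (T : 'End(l2 X)),
    [/\ quantum_graph T, irreflexive_qg T, noncommutative X,
        quantum_isomorphic T (adjacency R e) & strongly_regular T n k lambda mu].
Proof.
move=> ei sx tx sxt sr; exists X, twist_adjacency; split.
- exact: twist_quantum_graph.
- exact: twist_irreflexive.
- exact: twist_noncommutative sx tx sxt.
- exact: twist_quantum_isomorphic.
- exact: twist_strongly_regular.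
Qed.

End TwistedGraphProperties.

(** * Reflections of a generalized quadrangle *)

Section GeneralizedQuadrangle.
Variables (V : finType) (c : rel V) (th : V -> V -> V).
Hypothesis csym : symmetric c.
Hypothesis cirr : irreflexive c.
Hypothesis thP : forall u v, c u v -> c u (th u v) /\ c v (th u v).
Hypothesis th_uniq : forall u v w, c u v -> c u w -> c v w -> w = th u v.
Hypothesis gq : forall u v p, c u v -> ~~ c p u -> ~~ c p v -> c p (th u v).

(** For lines on a cubic surface this is the reflection in the root [x - y]: a line [w] meeting [x]
    but not [y] goes to [w + x - y], obtained by completing the triangles [x, w, z] and [y, z, w'].
    It exchanges the halves of a double-six and fixes the other 15 lines. *)
Definition reflection x y w :=
  if w == x then y else if w == y then x
  else if c x w && ~~ c y w then th y (th x w)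
  else if c y w && ~~ c x w then th x (th y w) else w.

Lemma reflection_sym x y w : x != y -> reflection x y w = reflection y x w.
Proof.
move=> xy; rewrite /reflection; have [->|wx] := eqVneq w x.
  by rewrite (negPf xy).
by case: (w == y); case: (c x w); case: (c y w).
Qed.

Lemma c_neq u v : c u v -> u != v.
Proof. by apply: contraTneq => ->; rewrite cirr. Qed.

Section Pair.
Variables x y : V.
Hypothesis xy : x != y.
Hypothesis nxy : ~~ c x y.
Local Notation s := (reflection x y).

Definition side u v w := c u w && ~~ c v w.

Lemma reflx : s x = y. Proof. by rewrite /reflection eqxx. Qed.

Lemma refly : s y = x.
Proof. by rewrite /reflection eqxx eq_sym (negPf xy). Qed.

Lemma refl_side w : side x y w -> s w = th y (th x w).
Proof.
move=> xyw; rewrite /reflection; case/andP: (xyw) => xw nyw.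
rewrite [X in if X then _ else _]eq_sym.
rewrite (negPf (c_neq xw)) (_ : w == y = false) ?xw ?nyw //.
by apply: contraNF nxy => /eqP <-.
Qed.

Lemma refl_side_th w : side x y w -> [/\ c x (th x w), c w (th x w) & c y (th x w)].
Proof.
case/andP=> xw nyw; have [? ?] := thP xw; split=> //.
by apply: gq => //; rewrite csym.
Qed.

Lemma refl_sideP w : side x y w -> side y x (s w).
Proof.
move=> xyw; rewrite refl_side //; have [xz wz yz] := refl_side_th xyw.
have [ya za] := thP yz; rewrite /side ya /=; apply/negP => xa.
case/andP: xyw => xw nyw.
(* An image collinear with [x] would be the third point of the line through [x] and [th x w], that
   is [w], which is not collinear with [y]. *)
have E : th y (th x w) = w.
  by rewrite (th_uniq xz xa za); apply/esym/th_uniq => //; rewrite csym.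
by rewrite E (negPf nyw) in ya.
Qed.

(** Otherwise [x], [b], [b'] form a line, and [y], collinear with neither [x] nor [b], would be
    collinear with [b']. *)
Lemma side_nadj b b' : side x y b -> side x y b' -> ~~ c b b'.
Proof.
move=> /andP[xb nyb] /andP[xb' nyb']; apply/negP => bb'.
have E := th_uniq xb xb' bb'; move: nyb'; rewrite E => /negP; apply.
by apply: gq => //; rewrite csym.
Qed.

Lemma refl_fixed w : w != x -> w != y -> c x w = c y w -> s w = w.
Proof.
by move=> wx wy E; rewrite /reflection (negPf wx) (negPf wy) E andbN.
Qed.

End Pair.

(** The middle point [th x w] is on both lines of the construction, so it serves for the way
    back. *)
Lemma refl_sideK x y w : x != y -> ~~ c x y -> side x y w ->
  reflection x y (reflection x y w) = w.
Proof.
move=> xy nxy xyw; have yxw := refl_sideP nxy xyw.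
have nyx : ~~ c y x by rewrite csym.
have yx : y != x by rewrite eq_sym.
rewrite (reflection_sym (reflection x y w) xy) refl_side //.
rewrite refl_side //; have [xz wz yz] := refl_side_th nxy xyw.
have [ya za] := thP yz; rewrite -(th_uniq ya yz) 1?csym //.
by apply/esym/th_uniq => //; [case/andP: xyw | rewrite csym].
Qed.

(** The incidence of a double-six, from which the reflection can be recovered. If [a] and [b] are
    not collinear, the quadrangle axiom for the line of [y] and [a] makes [b] collinear with
    [th y a]; then [b] completes the line of [x] and [th y a], which is how the image of [a] is
    built. *)
Lemma side_key x y a b : x != y -> ~~ c x y -> side x y b -> side y x a ->
  c b a = (a != reflection x y b).
Proof.
move=> xy nxy xyb yxa; have [xz bz yz] := refl_side_th nxy xyb.
have yxs := refl_sideP nxy xyb.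
case: eqP => [->|ab].
  rewrite refl_side //; have [ya za] := thP yz; apply/negP => ba.
  move: yxs; rewrite refl_side // => /andP[_ /negP]; apply.
  (* otherwise [b], [th x b] and the image of [b] would form a line, which contains [x] *)
  have xb : x = th b (th x b) by apply: th_uniq => //; rewrite csym //; case/andP: xyb.
  have := th_uniq bz ba za; rewrite -xb => E.
  by move: nxy; rewrite -E csym ya.
have [yz' az' xz'] := refl_side_th (x := y) (y := x) ltac:(by rewrite csym) yxa.
case/andP: (yxa) => ya nxa; case/andP: (xyb) => xb nyb.
apply/idPn => nba; case: ab.
have bz' : c b (th y a) by apply: gq => //; rewrite // csym.
have E : b = th x (th y a) by apply: th_uniq => //; rewrite csym.
have yx : y != x by rewrite eq_sym.
have nyx : ~~ c y x by rewrite csym.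
have Ea : reflection x y a = b by rewrite reflection_sym // refl_side.
by rewrite -Ea !(reflection_sym _ xy) refl_sideK.
Qed.

Section Reflection.
Variables x y : V.
Hypothesis xy : x != y.
Hypothesis nxy : ~~ c x y.
Local Notation s := (reflection x y).

Let yx : y != x. Proof. by rewrite eq_sym. Qed.
Let nyx : ~~ c y x. Proof. by rewrite csym. Qed.

Variant point_spec w : Prop :=
| PointL of w = x
| PointR of w = y
| PointLSide of side x y w
| PointRSide of side y x w
| PointFixed of w != x & w != y & c x w = c y w & s w = w.

Lemma pointP w : point_spec w.
Proof.
have [->|wx] := eqVneq w x; first exact: PointL.
have [->|wy] := eqVneq w y; first exact: PointR.
case xw: (c x w); case yw: (c y w).
- by apply: PointFixed; rewrite ?refl_fixed ?xw ?yw.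
- by apply: PointLSide; rewrite /side xw yw.
- by apply: PointRSide; rewrite /side xw yw.
- by apply: PointFixed; rewrite ?refl_fixed ?xw ?yw.
Qed.

Lemma reflK : involutive s.
Proof.
move=> w; case: (pointP w) => [->|->|xyw|yxw|_ _ _ E].
- by rewrite reflx refly.
- by rewrite refly // reflx.
- exact: refl_sideK.
- by rewrite !(reflection_sym _ xy) refl_sideK.
- by rewrite !E.
Qed.

Lemma refl_sideR w : side y x w -> side x y (s w).
Proof. by move=> yxw; rewrite reflection_sym //; apply: refl_sideP. Qed.

Lemma side_key_sym a b : side x y b -> side y x a -> c a b = (b != s a).
Proof.
by move=> xyb yxa; rewrite (side_key yx nyx yxa xyb) reflection_sym.
Qed.

Lemma refl_hom u w : c u w -> c (s u) (s w).
Proof.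
(* A moved point against a fixed one. If [f] is collinear with both [a] and [b], it is the middle
   point [th a b']. If with neither, it is not collinear with the middle point either, since it
   would then be the third point [a] of that line; the axiom for the line through [b] finishes. *)
have side_fixed (a b : V) b' f : a != b -> ~~ c a b -> side a b b' -> f != a -> c a f = c b f ->
    c b' f -> c (reflection a b b') f.
  move=> ab nab abb fa E bf; have [az bz' bz] := refl_side_th nab abb.
  have [ba' za'] := thP bz; rewrite refl_side //.
  case bf': (c b f); rewrite bf' in E.
    have -> : f = th a b' by apply: th_uniq => //; case/andP: abb.
    by rewrite csym.
  rewrite csym; apply: gq => //; first by rewrite csym bf'.
  apply/negP => fz; have Ef := th_uniq bz'  bf; rewrite csym in fz.
  have ab' : c a b' by case/andP: abb.
  have Ea : a = th b' (th a b') by apply: th_uniq => //; rewrite csym.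
  by move: fa; rewrite (Ef fz) -Ea eqxx.

have nc a b : c a b -> ~~ c a b -> False by move=> ->.
case: (pointP u) => [->|->|xyu|yxu|ux uy uE su];
  case: (pointP w) => [->|->|xyw|yxw|wx wy wE sw]; rewrite ?reflx ?refly ?su ?sw //.
- by rewrite cirr.
- by move/nc => /(_ nxy).
- by move=> _; have /andP[] := refl_sideP nxy xyw.
- by move/nc; case/andP: yxw => _ n /(_ n).
- by rewrite wE.
- by rewrite csym => /nc => /(_ nxy).
- by rewrite cirr.
- by move/nc; case/andP: xyw => _ n /(_ n).
- by move=> _; have /andP[] := refl_sideR yxw.
- by rewrite wE.
- by move=> _; rewrite csym; have /andP[] := refl_sideP nxy xyu.
- by rewrite csym => /nc; case/andP: xyu => _ n /(_ n).
- by move/nc => /(_ (side_nadj nxy xyu xyw)).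
- have xys := refl_sideR yxw; have yxs := refl_sideP nxy xyu.
  rewrite (side_key xy nxy xyu yxw) (side_key_sym xys yxs) reflK.
  by apply: contraNN => /eqP <-; rewrite reflK.
- exact: side_fixed.
- by rewrite csym => /nc; case/andP: yxu => _ n /(_ n).
- by move=> _; rewrite csym; have /andP[] := refl_sideR yxu.
- have xys := refl_sideR yxu; have yxs := refl_sideP nxy xyw.
  rewrite (side_key_sym xyw yxu) (side_key xy nxy xys yxs).
  by rewrite reflK; apply: contraNN => /eqP <-; rewrite reflK.
- by move/nc => /(_ (side_nadj nyx yxu yxw)).
- by rewrite !(reflection_sym _ xy); apply: side_fixed => //; rewrite wE.
- by rewrite csym uE csym.
- by rewrite csym -uE csym.
- by rewrite csym => uw; rewrite csym; apply: side_fixed uw.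
- by rewrite csym => uw; rewrite csym !(reflection_sym _ xy); apply: side_fixed uw.
Qed.

Lemma refl_aut u w : c (s u) (s w) = c u w.
Proof. by apply/idP/idP => /refl_hom //; rewrite !reflK. Qed.

(** A reflection can be rebuilt from other pairs that it exchanges. A further moved point is
    collinear with exactly one of [u] and [s u], hence lies on a side of the new pair, and
    [side_key] identifies its image as the one point of the opposite side not collinear with it. *)
Lemma refl_determined u : side y x u -> reflection u (s u) =1 s.
Proof.
move=> yxu w; have xyv := refl_sideR yxu.
have uv : u != s u.
  by apply/eqP => E; move: xyv yxu; rewrite -E /side => /andP[-> _] /andP[].
have nuv : ~~ c u (s u) by rewrite (side_key_sym xyv yxu) eqxx.
have [->|wu] := eqVneq w u; first by rewrite reflx.
have [->|wv] := eqVneq w (s u); first by rewrite refly // reflK.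
have moved : ~~ c w (s w) -> c u w != c (s u) w -> reflection u (s u) w = s w.
  move=> nws; have cu : c u (s w) = c (s u) w by rewrite -refl_aut reflK.
  have cv : c (s u) (s w) = c u w by rewrite refl_aut.
  case uw: (c u w); case vw: (c (s u) w) => // _.
    by apply/esym/eqP; rewrite -[_ == _]negbK -(side_key uv nuv) // /side ?cu ?cv uw vw.
  have vu : s u != u by rewrite eq_sym.
  have nvu : ~~ c (s u) u by rewrite csym.
  rewrite reflection_sym //.
  by apply/esym/eqP; rewrite -[_ == _]negbK -(side_key vu nvu) // /side ?cu ?cv uw vw.
case: (pointP w) => [wx|wy|xyw|yxw|_ _ _ sw].
- apply: moved; rewrite wx ?reflx //; case/andP: yxu => _; case/andP: xyv => xv _.
  by rewrite !(csym _ x) xv => /negPf ->.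
- apply: moved; rewrite wy ?refly //; case/andP: yxu => yu _; case/andP: xyv => _ nv.
  by rewrite !(csym _ y) yu (negPf nv).
- apply: moved; first by rewrite (side_key xy nxy xyw (refl_sideP nxy xyw)) eqxx.
  by rewrite (csym (s u)) (negPf (side_nadj nxy xyw xyv)) (side_key_sym xyw yxu) wv.
- apply: moved; first by rewrite (side_key_sym (refl_sideR yxw) yxw) eqxx.
  by rewrite (negPf (side_nadj nyx yxu yxw)) (side_key xy nxy xyv yxw) reflK wu.
rewrite sw; apply: refl_fixed => //.
by rewrite -{1}sw -{1}[u]reflK refl_aut.
Qed.

End Reflection.

Lemma refl_conj (f : V -> V) x y : ~~ c x y -> involutive f ->
  (forall u v, c (f u) (f v) = c u v) ->
  forall w, f (reflection x y w) = reflection (f x) (f y) (f w).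
Proof.
move=> nxy fK fc w; have nyx : ~~ c y x by rewrite csym.
have fth u v : c u v -> f (th u v) = th (f u) (f v).
  by move=> uv; have [? ?] := thP uv; apply: th_uniq; rewrite fc.
have fi := inv_inj fK.
have fside a b : ~~ c a b -> side a b w -> f (th b (th a w)) = th (f b) (th (f a) (f w)).
  move=> nab abw; have [_ _ bz] := refl_side_th nab abw.
  by rewrite !fth //; case/andP: abw.
rewrite /reflection !(inj_eq fi) !fc.
case: eqP => // _; case: eqP => // _.
case: ifP => [xyw|_]; first exact: fside.
by case: ifP => // yxw; apply: fside.
Qed.

(** Conjugating the reflection of [(x, z)] by that of [(x, y)] gives the reflection of [y] and the
    image of [z]. That image is also the image of [y] under the reflection of [(x, z)], so by
    [refl_determined] the conjugate is the same reflection. *)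
Lemma refl_comm x y z w : x != y -> ~~ c x y -> side y x z ->
  reflection x y (reflection x z w) = reflection x z (reflection x y w).
Proof.
move=> xy nxy yxz; case/andP: (yxz) => yz nxz.
have xz : x != z by apply: contraNneq nxy => ->; rewrite csym.
have yx : y != x by rewrite eq_sym.
have nyx : ~~ c y x by rewrite csym.
have nzx : ~~ c z x by rewrite csym.
have zxy : side z x y by rewrite /side csym yz.
rewrite (refl_conj nxz (reflK xy nxy) (refl_aut xy nxy)) reflx.
(* Both are built from [x] and the third point of the line through [y] and [z]. *)
have <- : reflection x z y = reflection x y z.
  rewrite reflection_sym // refl_side // [RHS]reflection_sym // refl_side //.
  have [yt zt] := thP yz; congr (th x _); apply: th_uniq => //.
  - by have [] := thP (u := z) (v := y) ltac:(by rewrite csym).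
  - by have [] := thP (u := z) (v := y) ltac:(by rewrite csym).
by rewrite (refl_determined xz nxz zxy).
Qed.

End GeneralizedQuadrangle.

(** * Strongly regular graphs *)

Section StronglyRegularCounts.
Context {R : realType} (V : finType) (e : rel V).
Local Notation C := R[i].
Local Notation A := {ffun V -> C^o}.
Local Notation Y := (classical_set R V).
Hypothesis ei : irreflexive e.
Hypothesis V0 : (0 < #|V|)%N.

Lemma adjacency_sq u v : (adjacency R e (adjacency R e (dirac v)) : A) u =
  #|[pred w | e u w & e w v]|%:R :> C.
Proof.
rewrite adjacencyE -sum1_card natr_sum big_mkcondr /=; apply: eq_bigr => w _.
rewrite adjacencyE; case wv: (e w v).
  by rewrite (bigD1 v) //= ffunE eqxx big1 ?addr0 // => x /andP[_ /negPf xv]; rewrite ffunE xv.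
by rewrite big1 // => x wx; rewrite ffunE; case: eqP => // xv; rewrite -xv wx in wv.
Qed.

(** The operator identity is compared entry by entry on Dirac functions; characteristic zero turns
    equal scalars into equal counts. *)
Lemma srg_countP n (k la mu : nat) :
  strongly_regular (adjacency R e) n k%:R la%:R mu%:R <->
  #|V| = n /\ forall u v, #|[pred w | e u w & e w v]| =
    if u == v then k else if e u v then la else mu.
Proof.
have oY := @classical_ogb R V V0.
have rhs v u : (((la%:R : C) *: adjacency R e + mu%:R *: compl_qg (adjacency R e) +
    k%:R *: \1%VF : 'End(l2 Y)) (dirac v) : A) u =
    (if u == v then k else if e u v then la else mu)%:R :> C.
  rewrite 2!add_lfunE 3!scale_lfunE id_lfunE.
  rewrite (compl_qgE oY (@classical_algebra R V) (@classical_involution R V)) dsq_classical.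
  have -> : qstate (dirac v : l2 Y) = #|V|%:R^-1.
    rewrite /= (bigD1 v) //= ffunE eqxx big1 ?addr0 ?div1r // => w wv.
    by rewrite ffunE (negPf wv).
  rewrite mulfV ?pnatr_eq0 -?lt0n //.
  have Av : (adjacency R e (dirac v) : A) u = (e u v)%:R :> C.
    rewrite adjacencyE; case uv: (e u v).
      by rewrite (bigD1 v) //= ffunE eqxx big1 ?addr0 // => x /andP[_ /negPf xv]; rewrite ffunE xv.
    by rewrite big1 // => x ux; rewrite ffunE; case: eqP => // xv; rewrite -xv ux in uv.
  transitivity ((la%:R : C) * (adjacency R e (dirac v) : A) u +
    mu%:R * (1 * 1 - (u == v)%:R - (adjacency R e (dirac v) : A) u) + k%:R * (u == v)%:R :> C).
    by rewrite !ffunE.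
  rewrite Av; case: eqP => [->|_]; first by rewrite ei /=; ring.
  by case: (e u v); rewrite /=; ring.
have dimE : \dim (@fullv _ (qsort Y)) = #|V| by rewrite dimvf /dim /= muln1.
split=> [[dimn H]|[Vn H]].
  split=> [|u v]; first by rewrite -dimE.
  apply/eqP; rewrite -(@eqr_nat C) -adjacency_sq -rhs -H comp_lfunE; exact/eqP.
split; first by rewrite dimE.
apply: (spans_eq (V := l2 Y) (@spans_dirac R V)) => v; apply/ffunP => u.
by rewrite rhs comp_lfunE -H; apply: adjacency_sq.
Qed.

End StronglyRegularCounts.

(** * The complement of a Schlaefli graph as a generalized quadrangle *)

Section SchlafliInvolutions.
Variables (V : finType) (e : rel V).
Hypothesis esym : symmetric e.
Hypothesis ei : irreflexive e.
Hypothesis V27 : #|V| = 27.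
Hypothesis ecount : forall u v, #|[pred w | e u w & e w v]| =
  if u == v then 16 else if e u v then 10 else 8.

Definition collinear u v := (u != v) && ~~ e u v.
Local Notation c := collinear.

Let csym : symmetric c.
Proof. by move=> u v; rewrite /c eq_sym esym. Qed.

Let cirr : irreflexive c.
Proof. by move=> u; rewrite /c eqxx. Qed.

Let Ne u := u |: [set w | e u w].

Lemma card_Ne u : #|Ne u| = 17.
Proof.
have E := ecount u u; rewrite eqxx in E.
rewrite cardsU1 inE ei (_ : #|_| = 16) // -E.
by apply: eq_card => w; rewrite !inE esym andbb.
Qed.

Lemma card_c u : #|[set w | c u w]| = 10.
Proof.
have -> : [set w | c u w] = ~: Ne u by apply/setP => w; rewrite !inE /collinear negb_or eq_sym.
by apply/eqP; rewrite -(eqn_add2l #|Ne u|) cardsC card_Ne V27.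
Qed.

(** Inclusion-exclusion for closed neighbourhoods of size 17: they share [10 + 2] points if [u] and
    [v] are adjacent and 8 if not, leaving [27 - 22] or [27 - 26] points outside. *)
Lemma card_cc u v : u != v ->
  #|[set w | c u w && c v w]| = if e u v then 5 else 1.
Proof.
move=> uv; have -> : [set w | c u w && c v w] = ~: (Ne u :|: Ne v).
  by apply/setP => w; rewrite !inE /collinear !negb_or (eq_sym u) (eq_sym v).
have cE : #|[set w | e u w && e w v]| = if e u v then 10 else 8.
  by have := ecount u v; rewrite (negPf uv) => <-; apply: eq_card => w; rewrite !inE.
have cI : #|Ne u :&: Ne v| = if e u v then 12 else 8.
  case euv: (e u v) in cE *.
    have -> : Ne u :&: Ne v = u |: (v |: [set w | e u w && e w v]).
      apply/setP => w; rewrite !inE; have [->|wu] := eqVneq w u; first by rewrite esym euv orbT.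
      by have [->|wv] := eqVneq w v; rewrite /= ?euv // (esym v w).
    by rewrite !cardsU1 !inE !ei (negPf uv) /= ?andbF cE.
  rewrite -cE; apply: eq_card => w; rewrite !inE.
  have [->|wu] := eqVneq w u; first by rewrite ei (esym v u) euv (negPf uv).
  by have [->|wv] := eqVneq w v; rewrite /= ?euv ?ei // (esym v w).
apply/eqP; rewrite -(eqn_add2l #|Ne u :|: Ne v|) cardsC V27.
rewrite -(eqn_add2r #|Ne u :&: Ne v|) addnAC cardsUI !card_Ne cI.
by case: (e u v).
Qed.

(** For collinear arguments there is exactly one candidate, so neither the choice nor the default
    [u] matters. *)
Definition third u v := odflt u [pick w | c u w && c v w].
Local Notation th := third.

Let cc_e u v : c u v -> e u v = false.
Proof. by case/andP => _ /negPf. Qed.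

Lemma third_set u v : c u v -> [set w | c u w && c v w] = [set th u v].
Proof.
move=> uv; have /andP[nuv _] := uv.
have /eqP/cards1P[z zE] : #|[set w | c u w && c v w]| = 1 by rewrite card_cc // cc_e.
rewrite /third; case: pickP => [w uvw|/(_ z)] /=.
  have : w \in [set w | c u w && c v w] by rewrite inE.
  by rewrite zE inE => /eqP ->.
by have := set11 z; rewrite -zE inE => ->.
Qed.

Lemma thirdP u v : c u v -> c u (th u v) /\ c v (th u v).
Proof.
by move=> uv; have := set11 (th u v); rewrite -third_set // inE => /andP.
Qed.

Lemma third_uniq u v w : c u v -> c u w -> c v w -> w = th u v.
Proof.
move=> uv uw vw; have : w \in [set th u v] by rewrite -third_set // inE uw.
by rewrite inE => /eqP.
Qed.

(** The three points of a line have 10 neighbours each, and any two of them share only the third.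
    The neighbourhoods together cover [10 + 10 - 1 + 10 - 2 = 27] points, that is everything. *)
Lemma collinear_gq u v p : c u v -> ~~ c p u -> ~~ c p v -> c p (th u v).
Proof.
move=> uv pu pv; pose N x := [set z | c x z]; set w := th u v.
have [uw vw] := thirdP uv; rewrite -/w in uw vw.
have NN x y : c x y -> N x :&: N y = [set th x y].
  by move=> xy; rewrite -third_set //; apply/setP => z; rewrite !inE.
have Euv : N u :&: N v = [set w] by rewrite NN.
have Euw : N u :&: N w = [set v].
  by rewrite NN // -(@third_uniq u w v) // csym.
have Evw : N v :&: N w = [set u].
  by rewrite NN // -(@third_uniq v w u) // csym.
have nuv : u != v by case/andP: uv.
have c1 : #|N u :|: N v| = 19.
  apply/eqP; rewrite -(eqn_add2r #|N u :&: N v|) cardsUI Euv cards1.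
  by rewrite !card_c.
have c2 : #|N u :|: N v :|: N w| = 27.
  apply/eqP; rewrite -(eqn_add2r #|(N u :|: N v) :&: N w|) cardsUI finset.setIUl Euw Evw.
  by rewrite cards2 (eq_sym v) nuv c1 card_c.
have /setP/(_ p) : N u :|: N v :|: N w = [set: V].
  by apply/eqP; rewrite eqEcard finset.subsetT cardsT V27 c2.
by rewrite !inE !(csym _ p) (negPf pu) (negPf pv).
Qed.

Lemma noncollinear_exists : exists x y z,
  [/\ x != y, ~~ c x y & side c y x z].
Proof.
have /card_gt0P[x _] : (0 < #|V|)%N by rewrite V27.
have /card_gt0P[y] : (0 < #|[pred w | e x w & e w x]|)%N by rewrite ecount eqxx.
rewrite inE => /andP[xy _].
have nxy : x != y by apply: contraTneq xy => ->; rewrite ei.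
(* Of the 10 points collinear with [y], only 5 are collinear with [x]. *)
have /card_gt0P[z] : (0 < #|[set w | c y w] :\: [set w | c x w]|)%N.
  rewrite cardsD card_c (_ : _ :&: _ = [set w | c y w && c x w]); last first.
    by apply/setP => w; rewrite !inE.
  by rewrite card_cc 1?eq_sym // esym xy.
rewrite !inE => /andP[nxz yz]; exists x, y, z; split=> //.
  by rewrite /c xy andbF.
by rewrite /side yz.
Qed.

Lemma collinear_e u v : e u v = (u != v) && ~~ c u v.
Proof.
by rewrite /c; have [->|_] := eqVneq u v; rewrite ?ei ?negbK.
Qed.

Lemma schlafli_involutions : exists s t : V -> V, exists x : V,
  [/\ involutive s, involutive t, forall v, s (t v) = t (s v),
      (forall u v, e (s u) (s v) = e u v) /\ (forall u v, e (t u) (t v) = e u v) &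
      [/\ s x != x, t x != x & s x != t x]].
Proof.
have [x [y [z [xy nxy yxz]]]] := noncollinear_exists; have /andP[yz nxz] := yxz.
have xz : x != z by apply: contraNneq nxy => ->; rewrite csym.
have refl_e a b : a != b -> ~~ c a b -> involutive (reflection c th a b) /\
    forall u v, e (reflection c th a b u) (reflection c th a b v) = e u v.
  move=> ab nab; have rK := reflK csym cirr thirdP third_uniq collinear_gq ab nab.
  split=> // u v; rewrite !collinear_e (inj_eq (inv_inj rK)).
  by rewrite (refl_aut csym cirr thirdP third_uniq collinear_gq ab nab).
have [sK se] := refl_e x y xy nxy; have [tK te] := refl_e x z xz nxz.
exists (reflection c th x y), (reflection c th x z), x; split=> //.
  by move=> v; apply: (refl_comm csym cirr thirdP third_uniq collinear_gq).
rewrite !reflx; split; rewrite 1?eq_sym // eq_sym.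
by apply: contraTneq yz => ->; rewrite cirr.
Qed.

End SchlafliInvolutions.

(** * The Schlaefli and Shrikhande graphs *)

Lemma card_ord_count n (P : pred nat) : #|[pred w : 'I_n | P w]| = count P (iota 0 n).
Proof.
rewrite -sum1_card -sum1_count -[in RHS](subn0 n) -/(index_iota 0 n) big_mkord.
by apply: eq_bigl => w; rewrite inE.
Qed.

(** The 28 pairs [i < j < 8] with one removed. *)
Definition line_labels : seq (nat * nat) :=
  [seq p <- [seq (i, j) | i <- iota 0 8, j <- iota 0 8] | (p.1 < p.2)%N && (p != (6, 7))].

(* The 27 lines on a cubic surface: (i, 6), (i, 7) and (i, j) with i < j < 6 stand for
   a_i, b_i and c_ij. *)
Definition meet_lines (k l : nat) : bool :=
  let p := nth (0, 0)%N line_labels k in let q := nth (0, 0)%N line_labels l in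
  (~~ has (mem [:: p.1; p.2]) [:: q.1; q.2]) (+) ((5 < p.2)%N != (5 < q.2)%N).

Definition schlafli_rel (k l : nat) : bool := (k != l) && ~~ meet_lines k l.

Lemma schlafli_check : all (fun k => all (fun l =>
    (schlafli_rel k l == schlafli_rel l k) &&
    (count (fun w => schlafli_rel k w && schlafli_rel w l) (iota 0 27) ==
      if k == l then 16 else if schlafli_rel k l then 10 else 8)%N)
  (iota 0 27)) (iota 0 27).
Proof. by vm_compute. Qed.

(** This keeps the universally quantified [schlafli_quantum] from being vacuous. *)
Lemma schlafli_exists (R : realType) : exists (V : finType) (e : rel V), is_schlafli R e.
Proof.
exists 'I_27, (fun k l : 'I_27 => schlafli_rel k l).
have chk (k l : 'I_27) := allP (allP schlafli_check k ltac:(by rewrite mem_iota ltn_ord)) l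
  ltac:(by rewrite mem_iota ltn_ord).
split=> [k l|k|]; first by have /andP[/eqP] := chk k l.
  by rewrite /schlafli_rel eqxx.
apply/srg_countP; rewrite ?card_ord //; first by move=> k; rewrite /schlafli_rel eqxx.
split=> // k l; have /andP[_ /eqP <-] := chk k l.
by rewrite -card_ord_count.
Qed.

Theorem schlafli_quantum (R : realType) (V : finType) (e : rel V) : is_schlafli R e ->
  exists (X : qset R) (T : 'End(l2 X)),
    [/\ quantum_graph T, irreflexive_qg T, noncommutative X,
        quantum_isomorphic T (adjacency R e) & strongly_regular T 27 16 10 8].
Proof.
move=> [esym ei sr]; have V0 : (0 < #|V|)%N.
  by have [dimV _] := sr; move: dimV; rewrite dimvf /dim /= muln1 => ->.
have [V27 cnt] := (srg_countP ei V0 _ _ _ _).1 sr.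
have [s [t [x [sK tK st [es et] [sx tx sxt]]]]] := schlafli_involutions esym ei V27 cnt.
exact: (twisted_graph V0 sK tK st es et ei sx tx sxt sr).
Qed.

(** Differences modulo 4 on naturals below 4; the entry 3 stands for -1. *)
Definition shrikhande_nat (a b c d : nat) : bool :=
  ((c + (4 - a)) %% 4, (d + (4 - b)) %% 4)%N \in
    [:: (1, 0); (3, 0); (0, 1); (0, 3); (1, 3); (3, 1)]%N.

Lemma shrikhandeE (u v : 'Z_4 * 'Z_4) : shrikhande u v = shrikhande_nat u.1 u.2 v.1 v.2.
Proof.
case: u => a b; case: v => c d.
have Z4B (x y : 'Z_4) : ((y + (4 - x)) %% 4)%N = (y - x)%R by rewrite /= modnDmr.
rewrite /shrikhande /shrikhande_nat /= !Z4B -[(c, d) - (a, b)]/(c - a, d - b).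
move: (c - a) (d - b) => x y.
by case: x => [[|[|[|[|//]]]] ?]; case: y => [[|[|[|[|//]]]] ?].
Qed.

Lemma card_Z4_count (P : nat -> nat -> bool) :
  #|[pred w : 'Z_4 * 'Z_4 | P w.1 w.2]| =
  sumn [seq count (P i) (iota 0 4) | i <- iota 0 4].
Proof.
rewrite -sum1_card -(pair_big_dep xpredT (fun i j : 'Z_4 => P i j) (fun _ _ => 1%N)).
rewrite sumnE big_map -[iota 0 4]/(index_iota 0 4) big_mkord; apply: eq_bigr => i _.
by rewrite -sum1_count big_mkord.
Qed.

Lemma shrikhande_check : all (fun a => all (fun b => all (fun c => all (fun d =>
    sumn [seq count (fun j => shrikhande_nat a b i j && shrikhande_nat i j c d) (iota 0 4)
         | i <- iota 0 4] ==
      (if (a == c) && (b == d) then 6 else if shrikhande_nat a b c d then 2 else 2)%N)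
  (iota 0 4)) (iota 0 4)) (iota 0 4)) (iota 0 4).
Proof. by vm_compute. Qed.

Lemma shrikhande_irreflexive : irreflexive shrikhande.
Proof. by move=> u; rewrite /shrikhande subrr. Qed.

Lemma shrikhande_srg (R : realType) : strongly_regular (adjacency R shrikhande) 16 6 2 2.
Proof.
have V16 : #|{: 'Z_4 * 'Z_4}| = 16 by rewrite card_prod card_ord.
apply/(srg_countP shrikhande_irreflexive); rewrite ?V16 //; split=> // u v.
have m4 (x : 'Z_4) : (x : nat) \in iota 0 4 by rewrite mem_iota ltn_ord.
have /eqP := allP (allP (allP (allP shrikhande_check _ (m4 u.1)) _ (m4 u.2)) _ (m4 v.1)) _ (m4 v.2).
rewrite -card_Z4_count -shrikhandeE => E.
transitivity (if (val u.1 == val v.1) && (val u.2 == val v.2) then 6 else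
  if shrikhande u v then 2 else 2)%N => //.
by rewrite -E; apply: eq_card => w; rewrite !inE !shrikhandeE.
Qed.

Lemma shrikhande_shift (d u v : 'Z_4 * 'Z_4) :
  shrikhande (u + d) (v + d) = shrikhande u v.
Proof. by rewrite /shrikhande opprD addrACA subrr addr0. Qed.

Lemma shrikhande_quantum (R : realType) :
  exists (X : qset R) (T : 'End(l2 X)),
    [/\ quantum_graph T, irreflexive_qg T, noncommutative X,
        quantum_isomorphic T (adjacency R shrikhande) & strongly_regular T 16 6 2 2].
Proof.
(* Translations are automorphisms of a Cayley graph, and those by elements of order two are
   involutions; the point 0 has distinct images under these two. *)
pose s (u : 'Z_4 * 'Z_4) := u + (2, 0); pose t (u : 'Z_4 * 'Z_4) := u + (0, 2).
have sK : involutive s.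
  by move=> u; rewrite /s -addrA (_ : (2, 0) + (2, 0) = 0) ?addr0 //; apply/eqP.
have tK : involutive t.
  by move=> u; rewrite /t -addrA (_ : (0, 2) + (0, 2) = 0) ?addr0 //; apply/eqP.
have st v : s (t v) = t (s v) by rewrite /s /t addrAC.
have V0 : (0 < #|{: 'Z_4 * 'Z_4}|)%N by rewrite card_prod card_ord.
apply: (@twisted_graph R _ s t shrikhande V0 sK tK st _ _ 0) => //.
- exact: shrikhande_shift.
- exact: shrikhande_shift.
- exact: shrikhande_irreflexive.
- exact: shrikhande_srg.
Qed.

Theorem corollary4 (R : realType) :
  (* (D1) *)
  ([/\ quantum_graph (qA4 R), irreflexive_qg (qA4 R), connected_qg (qA4 R) &
       three_point_regular (qA4 R) 3 2 0 1 0 0 0] /\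
   [/\ quantum_graph (qA3 R), irreflexive_qg (qA3 R), connected_qg (qA3 R) &
       three_point_regular (qA3 R) 2 0 2 0 0 0 0])
  /\
  (* (D2) *)
  ([/\ forall T : 'End(l2 (matrix_set R 3)),
         T \in [:: qG3 R; qG4 R; q9P R; qK9 R] ->
         [/\ quantum_graph T, irreflexive_qg T, real_qg T & undirected_qg T],
       pairwise (fun S T : 'End(l2 (matrix_set R 3)) =>
                   (S != T) && (S != compl_qg T))
                [:: qG3 R; qG4 R; q9P R; qK9 R] &
       [/\ three_point_regular (qG3 R) 2 1 0 0 0 0 0,
           three_point_regular (qG4 R) 3 (3 / 4) (3 / 4)
             (3 / 8) (- (3 / 8)) (3 / 8) (- (3 / 8)),
           three_point_regular (q9P R) 4 1 2 0 0 1 0 &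
           three_point_regular (qK9 R) 8 7 0 6 0 0 0]])
  /\
  (* (D3), first for the Schlaefli graph, then for the Shrikhande graph *)
  (((exists (V : finType) (e : rel V), is_schlafli R e) /\
    (forall (V : finType) (e : rel V), is_schlafli R e ->
       exists (X : qset R) (T : 'End(l2 X)),
         [/\ quantum_graph T, irreflexive_qg T, noncommutative X,
             quantum_isomorphic T (adjacency R e) &
             strongly_regular T 27 16 10 8]))
   /\
   (strongly_regular (adjacency R shrikhande) 16 6 2 2 /\
    (exists (X : qset R) (T : 'End(l2 X)),
       [/\ quantum_graph T, irreflexive_qg T, noncommutative X,
           quantum_isomorphic T (adjacency R shrikhande) &
           strongly_regular T 16 6 2 2]))).
Proof.
split; first by split; split; [have [] := @qA4_graph R|have [] := @qA4_graph R
  |exact: qA4_connected|exact: qA4_three_point|have [] := @qA3_graph R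
  |have [] := @qA3_graph R|exact: qA3_connected|exact: qA3_three_point].
split; first by split; [exact: M3_graphs|exact: M3_distinct|split;
  [exact: qG3_three_point|exact: qG4_three_point|exact: q9P_three_point|exact: qK9_three_point]].
split; first by split; [exact: schlafli_exists|exact: schlafli_quantum].
by split; [exact: shrikhande_srg|exact: shrikhande_quantum].
Qed.
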